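(* Let $m\ge2$, let $p_1,\dots,p_m>0$ with $\sum_i p_i=1$ be linearly independent over $\mathbb{Q}$, and let $\beta\in\mathbb{R}$. Consider the $\beta$-linear divisor method with $N$ uniformly distributed on $\{1,\dots,N_0\}$. Then, as $N_0\to\infty$, for each $i$, $$\Delta_i\xrightarrow{\mathrm d}\bar X_i:=\bigl(\beta-\tfrac12\bigr)(mp_i-1)+\widetilde U_0+p_i\sum_{k=1}^{m-2}\widetilde U_k,$$ where $\widetilde U_0,\dots,\widetilde U_{m-2}$ are independent and uniform on $(-\frac12,\frac12)$. Moreover, jointly for $i=1,\dots,m$, $\Delta_i\xrightarrow{\mathrm d}X_i$, i.e. $(\Delta_1,\dots,\Delta_m)\xrightarrow{\mathrm d}(X_1,\dots,X_m)$, where $X_1,\dots,X_m$ are constructed as follows: let $U_1,\dots,U_m$ be uniform on $(0,1)$ and let $J\in\{1,\dots,m\}$ be random with $\mathbb{P}(J=j)=p_j$ for $j=1,\dots,m$, all these variables being independent; let $V_i:=U_i$ if $i\ne J$ and $V_i:=0$ if $i=J$; and let $$X_i:=p_i\sum_{j=1}^m V_j-V_i+(\beta-1)(mp_i-1).$$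
   Context: There are $m$ parties; party $i$ has proportion $p_i>0$ of the votes. $N$ (the house size) seats are distributed, party $i$ gets $s_i=s_i(N)$ seats with $\sum_i s_i=N$, and the seat excess is $\Delta_i=s_i-Np_i$. For real $\alpha,x$, the $\alpha$-rounding $[x]_\alpha$ is an integer $n$ with $x-\alpha\le n\le x-\alpha+1$ (if $x-\alpha\in\mathbb{Z}$, both $x-\alpha$ and $x-\alpha+1$ are accepted values). The $\beta$-linear divisor method: $s_i=\max\{[p_i/D']_\beta,0\}$ where the real number $D'>0$ (and the choices of rounding in case of ties) are such that $\sum_i s_i=N$. The maximum with $0$ only matters if $\beta>1$ and $N$ is small; if $\beta\le 0$ the method is defined only for $N\ge m(\lfloor|\beta|\rfloor+1)$. Ties are resolved at random. Finitely many $N$ for which the method is undefined are irrelevant for the limit and may be ignored. $\xrightarrow{\mathrm d}$ denotes convergence in distribution. *)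

(* Defs.v *)
From HB Require Import structures.
From mathcomp Require Export all_boot all_order all_algebra.
From mathcomp Require Export all_classical all_reals all_analysis.
Set Implicit Arguments.
Unset Strict Implicit.
Unset Printing Implicit Defensive.
Import Order.TTheory GRing.Theory Num.Theory.
Import numFieldNormedType.Exports.
Local Open Scope classical_set_scope.
Local Open Scope ring_scope.

Section DivisorMethod.
Context {R : realType}.

(* Relational: when [x - alpha] is an integer, two values of [n] qualify. *)
Definition is_rounding (alpha x : R) (n : int) : Prop :=
  x - alpha <= n%:~R <= x - alpha + 1.

(* A relation: [s] is one of the outcomes permitted when ties occur. *)
Definition divisor_allocation m (p : 'I_m -> R) (beta : R) (N : nat)
    (s : 'I_m -> nat) : Prop :=
  exists2 D : R, 0 < D &
    (exists2 r : 'I_m -> int,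
       forall i, is_rounding beta (p i / D) (r i) &
       forall i, (s i)%:Z = Num.max (r i) 0) /\
    (\sum_i s i)%N = N.

(* Smaller houses have no allocation when [beta <= 0]. *)
Definition divisor_defined (m : nat) (beta : R) (N : nat) : Prop :=
  beta <= 0 -> m%:Z * (Num.floor `|beta| + 1) <= N%:Z.

Definition seat_excess m (p : 'I_m -> R) (N : nat) (s : 'I_m -> nat)
    (i : 'I_m) : R :=
  (s i)%:R - N%:R * p i.

Definition rat_independent m (p : 'I_m -> R) : Prop :=
  forall c : 'I_m -> rat, \sum_i ratr (c i) * p i = 0 -> forall i, c i = 0.

End DivisorMethod.

Section Probability.
Context {R : realType}.

Definition uniform_upto d (T : measurableType d) (P : probability T R)
    (N0 : nat) (N : T -> nat) : Prop :=
  forall k, (1 <= k <= N0)%N -> P (N @^-1` [set k]) = (N0%:R^-1)%:E.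

Definition uniform_on d (T : measurableType d) (P : probability T R)
    (a b : R) (ab : a < b) (X : {RV P >-> R}) : Prop :=
  forall A : set R, measurable A -> distribution P X A = uniform_prob ab A.

Lemma ltNhalf : - 2^-1 < 2^-1 :> R.
Proof. by rewrite gtrN// invr_gt0. Qed.

Definition independent_systems d (T : measurableType d) (P : probability T R)
    (I : finType) (F : I -> set_system T) : Prop :=
  forall (B : {set I}) (A : I -> set T),
    (forall i, i \in B -> F i (A i)) ->
    P (\bigcap_(i in [set` B]) A i) = (\prod_(i in B) P (A i))%E.

Definition events_of d (T : measurableType d) d' (S : measurableType d')
    (X : T -> S) : set_system T :=
  preimage_set_system setT X measurable.

(* [S] carries no canonical sigma-algebra: all its subsets are used. *)
Definition events_of_fin d (T : measurableType d) (S : finType)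
    (X : T -> S) : set_system T :=
  preimage_set_system setT X setT.

(* The terms and the limit may live on different
   probability spaces. *)
Definition cvg_in_distribution d (T : nat -> measurableType d)
    (P : forall n, probability (T n) R)
    d' (T' : measurableType d') (Q : probability T' R)
    (E : topologicalType) (X : forall n, T n -> E) (Y : T' -> E) : Prop :=
  forall f : E -> R, continuous f -> bounded_fun f ->
    ('E_(P n)[f \o X n])%E @[n --> \oo] --> ('E_Q[f \o Y])%E.

End Probability.

Section Limit.
Context {R : realType} (m : nat) (p : 'I_m -> R) (beta : R).
Context d (T : measurableType d).

(* Of the sequence [Ut], only the terms of index at most [m - 2] are used. *)
Definition limit_marginal (Ut : nat -> T -> R) (i : 'I_m) (w : T) : R :=
  (beta - 2^-1) * (m%:R * p i - 1) + Ut 0%N w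
  + p i * \sum_(1 <= k < m.-1) Ut k w.

Definition zeroed_at (U : 'I_m -> T -> R) (J : T -> 'I_m) (i : 'I_m) (w : T) : R :=
  if i == J w then 0 else U i w.

Definition limit_joint (U : 'I_m -> T -> R) (J : T -> 'I_m) (i : 'I_m) (w : T) : R :=
  p i * \sum_j zeroed_at U J j w - zeroed_at U J i w
  + (beta - 1) * (m%:R * p i - 1).

End Limit.

(* Main.v *)
Require Import Defs.
From mathcomp Require Import all_boot all_order perm all_algebra.
From mathcomp Require Import all_classical all_reals all_analysis.
From mathcomp Require Import measurable_realfun.
From mathcomp Require Import complex zify ring lra.
Import Order.TTheory GRing.Theory Num.Theory.
Import numFieldNormedType.Exports.
Local Open Scope classical_set_scope.
Local Open Scope ring_scope.

(* When the house grows, seats are handed out one at a time as t = 1/D increases: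
   the house reaches size N when some party j jumps to s_j seats, at time
   t = (s_j + beta - 1) / p_j.  Put v_i = t p_i - beta + 1 - s_i; then v_j = 0,
   0 <= v_i <= 1, and the seat excesses are an explicit affine function of v.
   Modulo 1, (v_i)_{i <> j} is the linear sequence (s_j + beta - 1) p_i / p_j - beta,
   which is equidistributed by Weyl's theorem since the p_i are independent over Q.
   Ties do not occur for large N, so N is determined by (j, s_j), and a fraction p_j
   of the houses belongs to party j.  Only an upper bound on the probability that
   v falls in a given cell of side 1/K is needed, because these bounds sum to 1; it
   follows from majorizing the cell by a product of nonnegative trigonometric
   polynomials of almost the same mean.  Expectations are then compared with the
   same Riemann sum on the house side and on the side of the limit.  For the
   marginal law, p_i V_k - (1 - p_i) V_i with k <> i is uniform on (p_i - 1, p_i) when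
   (V_i, V_k) is (0, U) with probability p_i and (U, 0) otherwise. *)

(** * Characters and Weyl sums *)

Definition cis {R : realType} (x : R) : R[i] :=
  Complex (cos (pi *+ 2 * x)) (sin (pi *+ 2 * x)).

Section Cis.
Context {R : realType}.
Implicit Types (x y : R) (z : int) (n : nat).

Lemma cisD x y : cis (x + y) = cis x * cis y.
Proof.
rewrite /cis mulrDr cosD sinD.
by congr Complex; rewrite addrC; congr +%R; rewrite mulrC.
Qed.

Lemma cis0 : cis (0 : R) = 1.
Proof. by rewrite /cis mulr0 cos0 sin0. Qed.

Lemma cisN x : cis (- x) = (cis x)^*%C.
Proof. by rewrite /cis mulrN cosN sinN. Qed.

Lemma norm_cis x : `|cis x| = 1.
Proof. by rewrite normc_def /= cos2Dsin2 sqrtr1. Qed.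

Lemma cis_mulrn n x : cis (n%:R * x) = cis x ^+ n.
Proof.
elim: n => [|n IH]; first by rewrite mul0r cis0 expr0.
by rewrite -natr1 mulrDl mul1r cisD IH exprSr.
Qed.

Lemma cis1 : cis (1 : R) = 1.
Proof. by rewrite /cis mulr1 cos2pi sin2pi. Qed.

Lemma cis_int z : cis (z%:~R : R) = 1.
Proof.
have cisn n : cis (n%:R : R) = 1.
  by rewrite -[n%:R]mulr1 cis_mulrn cis1 expr1n.
case: z => n; first exact: cisn.
by rewrite NegzE mulrNz cisN cisn conjc1.
Qed.

Lemma cisDint x z : cis (x + z%:~R) = cis x.
Proof. by rewrite cisD cis_int mulr1. Qed.

Lemma cis_sum (I : finType) (F : I -> R) :
  cis (\sum_i F i) = \prod_i cis (F i).
Proof. by apply: (big_morph _ cisD cis0). Qed.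

(** The real part of 1 - [cis x] is 1 - cos (2 pi x), and cosine decreases on [0, pi]; points beyond
    1/2 are reflected to 1 - x. *)
Lemma cis_far d : 0 < d -> d < 1 / 2 -> exists2 c : R, 0 < c &
  forall x, d <= x <= 1 - d -> c%:C%C <= `|cis x - 1|.
Proof.
move=> d0 d12; exists (1 - cos (pi *+ 2 * d)).
  have pi0 := @pi_gt0 R.
  rewrite subr_gt0 -cos0 ltr_cos ?mulr_gt0 ?in_itv/= ?lexx ?pi_ge0//; nra.
move=> x /andP[dx xd].
have pi0 := @pi_gt0 R.
have H : cos (pi *+ 2 * x) <= cos (pi *+ 2 * d).
  have [x12|x12] := leP x (1 / 2).
    rewrite leNgt ltr_cos -?leNgt ?in_itv/=; nra.
  rewrite -[cos (_ * x)]cosN -cosD2pi.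
  have -> : - (pi *+ 2 * x) + pi *+ 2 = pi *+ 2 * (1 - x) :> R by ring.
  rewrite leNgt ltr_cos -?leNgt ?in_itv/=; nra.
apply: (le_trans _ (normc_ge_Re _)); rewrite lecR /= distrC ger0_norm ?lerD2l ?lerN2//.
Qed.

(** The fractional part y of a non-integer keeps a positive distance from 0 and 1, so [cis_far]
    separates [cis y] from 1. *)
Lemma cis_eq1 x : cis x = 1 -> exists z, x = z%:~R.
Proof.
move=> x1; exists (Num.floor x); apply/eqP; rewrite -subr_eq0; apply/negPn/negP => xn0.
set y := x - (Num.floor x)%:~R in xn0.
have y1 : cis y = 1 by rewrite /y -mulrNz cisDint.
have y0 : 0 < y by rewrite lt_neqAle eq_sym xn0 /y subr_ge0 floor_le_tmp.
have ylt1 : y < 1 by have := floorD1_gt x; rewrite /y intrD; lra.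
have [dy dy1] : Num.min y (1 - y) <= y /\ Num.min y (1 - y) <= 1 - y.
  by rewrite !ge_min !lexx orbT.
have d0 : 0 < Num.min y (1 - y) by rewrite lt_min y0 subr_gt0.
have [||c c0 cP] := @cis_far (Num.min y (1 - y) / 2); [lra|lra|].
suff : c%:C%C <= (0 : R)%:C%C by rewrite lecR leNgt c0.
by apply: (le_trans (cP y _)); [lra|rewrite y1 subrr normr0].
Qed.
End Cis.

Definition trig_sum {R : realType} {I : finType} (c : I -> R[i]) (f : I -> int) (x : R) : R[i] :=
  \sum_a c a * cis ((f a)%:~R * x).

(** The integral of [trig_sum c f] over a period; frequencies may repeat, so several indices can
    contribute. *)
Definition trig_mean {R : realType} {I : finType} (c : I -> R[i]) (f : I -> int) : R[i] :=
  \sum_(a | f a == 0) c a.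

Section Weyl.
Context {R : realType}.

(** A geometric sum whose ratio [cis t] differs from 1, bounded by 2 / |cis t - 1| whatever its
    length. *)
Lemma weyl_bound (t u : R) : ~ (exists z : int, t = z%:~R) ->
  exists C : R[i], forall L : nat, `|\sum_(n < L) cis (n%:R * t + u)| <= C.
Proof.
move=> tz; have t1 : cis t - 1 != 0.
  by rewrite subr_eq0; apply/eqP => /cis_eq1.
exists (2 / `|cis t - 1|) => L.
have -> : \sum_(n < L) cis (n%:R * t + u) = cis u * ((cis t ^+ L - 1) / (cis t - 1)).
  rewrite subrX1 mulrAC divff// mul1r mulr_sumr; apply: eq_bigr => n _.
  by rewrite cisD cis_mulrn mulrC.
rewrite normrM norm_cis mul1r normf_div ler_pM2r ?invr_gt0 ?normr_gt0//.
by rewrite (le_trans (ler_normB _ _))// normrX norm_cis expr1n normr1.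
Qed.

(** Expanding the product gives one character for each choice [phi] of a term in every factor. By
    independence its frequency [th phi] is not an integer, so its sums stay bounded, unless all
    chosen frequencies vanish; then its sum is exactly L. *)
Lemma weyl_prod (D I : finType) (alpha gamma : D -> R) (c : D -> I -> R[i])
    (f : I -> int) :
  (forall k : D -> int, (exists z : int, \sum_i (k i)%:~R * alpha i = z%:~R) ->
     forall i, k i = 0) ->
  exists C : R[i], forall L : nat,
    `|\sum_(n < L) \prod_i trig_sum (c i) f (n%:R * alpha i + gamma i)
      - L%:R * \prod_i trig_mean (c i) f| <= C.
Proof.
move=> indep.
pose th (phi : {ffun D -> I}) : R := \sum_i (f (phi i))%:~R * alpha i.
pose ga (phi : {ffun D -> I}) : R := \sum_i (f (phi i))%:~R * gamma i.
pose cc (phi : {ffun D -> I}) := \prod_i c i (phi i).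
pose zz (phi : {ffun D -> I}) := [forall i, f (phi i) == 0].
have E1 n : \prod_i trig_sum (c i) f (n%:R * alpha i + gamma i) =
    \sum_phi cc phi * cis (n%:R * th phi + ga phi).
  rewrite /trig_sum bigA_distr_bigA /=; apply: eq_bigr => phi _.
  rewrite big_split /=; congr (_ * _); rewrite -cis_sum; congr cis.
  rewrite /th /ga mulr_sumr -big_split /=; apply: eq_bigr => i _.
  by rewrite mulrDr mulrCA.
have E2 : \prod_i trig_mean (c i) f = \sum_phi cc phi * (zz phi)%:R.
  rewrite /trig_mean; under eq_bigr do rewrite big_mkcond.
  rewrite bigA_distr_bigA /=; apply: eq_bigr => phi _.
  have [/forallP z|/forallPn[i zi]] := boolP (zz phi).
    by rewrite mulr1; apply: eq_bigr => i _; rewrite z.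
  by rewrite mulr0 (bigD1 i)//= (negbTE zi) mul0r.
have /choice[C CP] : forall phi, exists C : R[i], forall L : nat,
    `|\sum_(n < L) cis (n%:R * th phi + ga phi) - L%:R * (zz phi)%:R| <= C.
  move=> phi; have [/forallP z|/forallPn[i zi]] := boolP (zz phi).
    exists 0 => L; rewrite mulr1 (eq_bigr (fun=> 1)).
      by rewrite sumr_const card_ord subrr normr0.
    move=> n _; rewrite /th /ga !big1 ?mulr0 ?addr0 ?cis0// => i _;
    by rewrite (eqP (z i)) mul0r.
  have [|C CP] := @weyl_bound (th phi) (ga phi).
    by move=> /(indep (fun i => f (phi i)))/(_ i)/eqP; apply/negP.
  by exists C => L; rewrite mulr0 subr0.
exists (\sum_phi `|cc phi| * C phi) => L.
rewrite [X in X - _](eq_bigr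
  (fun n : 'I_L => \sum_phi cc phi * cis (n%:R * th phi + ga phi))); last first.
  by move=> n _; exact: E1.
rewrite exchange_big E2 mulr_sumr /= -sumrB; apply: le_trans (ler_norm_sum _ _ _) _.
apply: ler_sum => phi _; rewrite -mulr_sumr mulrCA -mulrBr normrM.
apply: ler_wpM2l; [exact: normr_ge0|exact: CP].
Qed.
End Weyl.

(** * Fejer kernels *)

Section Fejer.
Context {R : realType}.

(** Normalized to have peak value 1 and mean 1/M, so that M equally spaced translates form a
    partition of unity. *)
Definition fejer (M : nat) (x : R) : R[i] :=
  `|\sum_(k < M) cis (k%:R * x)| ^+ 2 / M%:R ^+ 2.

Lemma fejer_ge0 M x : 0 <= fejer M x.
Proof. by rewrite divr_ge0// exprn_ge0. Qed.

Lemma fejerE M x : fejer M x =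
  \sum_(a : 'I_M * 'I_M) M%:R ^- 2 * cis ((a.1%:Z - a.2%:Z)%:~R * x).
Proof.
have conjE : (\sum_(k < M) cis (k%:R * x))^*%C = \sum_(k < M) cis (- (k%:R * x)).
  by rewrite rmorph_sum; apply: eq_bigr => k _; rewrite cisN.
rewrite /fejer sqr_normc conjE mulr_suml mulrC mulr_sumr.
under eq_bigr do rewrite mulr_sumr mulr_sumr.
rewrite pair_big /=; apply: eq_bigr => -[a b] _ /=.
by rewrite -cisD intrD mulrDl mulrNz mulNr.
Qed.

(** Orthogonality of the characters of Z/M: if a and b differ, then 0 < |a - b| < M, and the ratio
    of the geometric sum is an M-th root of unity other than 1. *)
Lemma roots_of_unity_sum M (a b : 'I_M) :
  \sum_(l < M) cis ((a%:Z - b%:Z)%:~R * - (l%:R / M%:R)) = (a == b)%:R * M%:R :> R[i].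
Proof.
have M0 : (0 < M)%N by case: M a {b} => [[]|].
have MR : M%:R != 0 :> R by rewrite pnatr_eq0 -lt0n.
have [->|ab] := eqVneq a b.
  under eq_bigr do rewrite subrr mul0r cis0.
  by rewrite sumr_const card_ord mul1r.
rewrite mul0r; set t : R := - ((a%:Z - b%:Z)%:~R / M%:R).
have -> : \sum_(l < M) cis ((a%:Z - b%:Z)%:~R * - (l%:R / M%:R)) = \sum_(l < M) cis t ^+ l.
  by apply: eq_bigr => l _; rewrite -cis_mulrn; congr cis; rewrite /t; ring.
have t1 : cis t != 1.
  apply/eqP => /cis_eq1[z tz].
  have /eqP : (a%:Z - b%:Z)%:~R = - z%:~R * M%:R :> R by rewrite -tz /t opprK divfK.
  rewrite -mulrNz -[M%:R]/(M%:Z%:~R) -intrM eqr_int => /eqP H.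
  have : (`|a%:Z - b%:Z| < M)%N.
    have := ltn_ord a; have := ltn_ord b; lia.
  rewrite H abszM absz_nat ltnNge leq_pmull// abszN lt0n absz_eq0.
  apply: contra_neq ab => z0; move: H; rewrite z0 oppr0 mul0r => /eqP.
  by rewrite subr_eq0 => /eqP[] /val_inj.
apply: (mulfI (_ : cis t - 1 != 0)); first by rewrite subr_eq0.
rewrite -subrX1 mulr0 -cis_mulrn; apply/eqP; rewrite subr_eq0; apply/eqP.
have -> : M%:R * t = (b%:Z - a%:Z)%:~R.
  by rewrite /t mulrN mulrC divfK// -mulrNz opprB.
exact: cis_int.
Qed.

(** Summation over the translates kills the off-diagonal terms of [fejerE]; the M diagonal ones
    contribute 1/M each. *)
Lemma fejer_sum1 M x : (0 < M)%N -> \sum_(l < M) fejer M (x - l%:R / M%:R) = 1.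
Proof.
move=> M0; have MC : M%:R != 0 :> R[i] by rewrite pnatr_eq0 -lt0n.
under eq_bigr do rewrite fejerE.
rewrite exchange_big /=.
transitivity (\sum_(a : 'I_M * 'I_M) if a.1 == a.2 then M%:R^-1 else 0 : R[i]).
  apply: eq_bigr => -[a b] _ /=.
  under eq_bigr do rewrite mulrDr cisD.
  rewrite -mulr_sumr -mulr_sumr roots_of_unity_sum.
  case: eqP => [->|]; last by rewrite mul0r !mulr0.
  by rewrite subrr mul0r cis0 !mul1r expr2 invfM mulfVK.
rewrite -(pair_big xpredT xpredT (fun a b : 'I_M => if a == b then M%:R^-1 else 0 : R[i])) /=.
rewrite (eq_bigr (fun=> M%:R^-1 : R[i])) => [|a _]; last first.
  by rewrite -big_mkcond (big_pred1 a)// => b; rewrite /= eq_sym.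
by rewrite sumr_const card_ord -[_ *+ M]mulr_natl divff.
Qed.

(** The geometric sum is at most 2/c, so a far kernel is O(1/M^2), and M of them together are
    O(1/M). *)
Lemma fejer_far M (x c : R) : 0 < c -> c%:C%C <= `|cis x - 1| ->
  fejer M x <= (4 / c ^+ 2 / M%:R ^+ 2)%:C%C.
Proof.
move=> c0 cx.
have cC : 0 < c%:C%C :> R[i] by rewrite ltcR.
have n0 : 0 < `|cis x - 1| by apply: lt_le_trans cx.
have H : `|\sum_(k < M) cis (k%:R * x)| <= 2 / c%:C%C.
  rewrite ler_pdivlMr//; apply: (@le_trans _ _ (`|cis x ^+ M - 1|)).
    rewrite subrX1 normrM mulrC.
    rewrite (eq_bigr (fun i : 'I_M => cis x ^+ i)) ?ler_wpM2r// => k _.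
    exact: cis_mulrn.
  by rewrite (le_trans (ler_normB _ _))// normrX norm_cis expr1n normr1.
rewrite /fejer !rmorphM /= !fmorphV /= !rmorphXn /= !rmorph_nat ler_wpM2r ?invr_ge0 ?exprn_ge0//.
have -> : 4 / c%:C%C ^+ 2 = (2 / c%:C%C) ^+ 2 by rewrite expr_div_n -natrX.
by rewrite lerXn2r ?nnegrE ?divr_ge0// ltW.
Qed.
End Fejer.

(** * Trigonometric majorants of cells *)

Lemma card_ord_lt (M w : nat) : (#|[pred l : 'I_M | (l < w)%N]| <= w)%N.
Proof.
have [Mw|wltM] := leqP M w; first by rewrite (leq_trans (max_card _))// card_ord.
by rewrite -sum1_card -(big_ord_widen _ (fun=> 1%N)) ?sum1_card ?card_ord// ltnW.
Qed.

Section Majorant.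
Context {R : realType}.

(* The Fejer kernels centred at the multiples of 1/M sum to 1, and the omitted ones
   are small on the arc. *)
Lemma fejer_arc (M r w : nat) (A d c x : R) : (0 < M)%N -> 0 < c ->
  (forall y, d <= y <= 1 - d -> c%:C%C <= `|cis y - 1|) ->
  d <= r%:R / M%:R -> A + (2 * r)%:R / M%:R <= w%:R / M%:R ->
  0 <= x <= A ->
  1 - (4 / c ^+ 2 / M%:R)%:C%C <=
    \sum_(l < M | (l < w)%N) fejer M (x + r%:R / M%:R - l%:R / M%:R).
Proof.
move=> M0 c0 cP dr Aw /andP[x0 xA].
have MR : 0 < M%:R :> R by rewrite ltr0n.
rewrite -(@fejer_sum1 R M (x + r%:R / M%:R) M0) (bigID (fun l : 'I_M => (l < w)%N)) /=.
rewrite lerBlDr lerD2l.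
apply: (@le_trans _ _ (\sum_(l < M | ~~ (l < w)%N) (4 / c ^+ 2 / M%:R ^+ 2)%:C%C)).
  apply: ler_sum => l lw; apply: fejer_far => //.
  rewrite -(@cisDint _ _ 1) cP//.
  rewrite -leqNgt in lw; have lM := ltn_ord l.
  have l1 : l%:R / M%:R <= (M%:R - 1) / M%:R :> R.
    by rewrite ler_pM2r ?invr_gt0// lerBrDr natr1 ler_nat.
  have l2 : w%:R / M%:R <= l%:R / M%:R :> R.
    by rewrite ler_pM2r ?invr_gt0// ler_nat.
  rewrite mulrBl divff ?gt_eqF// in l1.
  have M1 : 0 < M%:R^-1 :> R by rewrite invr_gt0.
  have : (2 * r)%:R / M%:R = r%:R / M%:R + r%:R / M%:R :> R by rewrite natrM; ring.
  lra.
rewrite sumr_const -rmorphMn /= lecR.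
apply: (@le_trans _ _ ((4 / c ^+ 2 / M%:R ^+ 2) *+ M)).
  apply: ler_wpMn2l; last by rewrite (leq_trans (max_card _))// card_ord.
  by rewrite !divr_ge0// exprn_ge0// ltW.
rewrite -mulr_natr le_eqVlt; apply/orP; left; apply/eqP; field.
by rewrite !gt_eqF.
Qed.

(** The majorant is the sum of the Fejer kernels centred in the arc widened by d on both sides,
    divided by the lower bound 1 - eta that this sum has on the arc. Its mean is close to the length
    of the widened arc. *)
Lemma arc_majorant (K : nat) (e : R) : (0 < K)%N -> 0 < e ->
  exists (I : finType) (f : I -> int) (c : I -> R[i]) (mu : R),
  [/\ forall x, 0 <= trig_sum c f x,
      forall x, 0 <= x <= K%:R^-1 -> 1 <= trig_sum c f x,
      trig_mean c f = mu%:C%C & 0 <= mu <= K%:R^-1 + e].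
Proof.
move=> K0 e0.
have KR : 1 <= K%:R :> R by rewrite ler1n.
(* The choice of s makes the widening d = 1/(K s) at most e/8 and less than 1/2. *)
have [s /andP[s1 s2]] : exists s : nat, (8 / e < s%:R :> R) && (2 < s%:R :> R).
  exists (Num.truncn (8 / e + 2)).+1.
  have := truncnS_gt (8 / e + 2); have : 0 < 8 / e by rewrite divr_gt0.
  lra.
pose d : R := (K%:R * s%:R)^-1.
have s0 : 0 < s%:R :> R by lra.
have Ks : s%:R <= K%:R * s%:R :> R by rewrite ler_peMl// ltW.
have d0 : 0 < d by rewrite invr_gt0; lra.
have d12 : d < 1 / 2 by rewrite /d div1r ltf_pV2 ?posrE; lra.
have de : 2 * d <= e / 4.
  have : d <= e / 8.
    rewrite /d -div1r ler_pdivrMr; last lra.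
    have : 8 < s%:R * e by rewrite -ltr_pdivrMr.
    nra.
  lra.
have [c c0 cP] := cis_far _ d0 d12.
have c20 : 0 < c ^+ 2 by rewrite exprn_gt0.
(* As M >= r > B, the three terms give 1/M <= e/4, eta <= 1/2 and eta (1 + e) <= e/2
   respectively. *)
pose B := 4 / e + 8 / c ^+ 2 + 8 * (1 + e) / (c ^+ 2 * e).
have [r rB] : exists r : nat, B < r%:R by exists (Num.truncn B).+1; exact: truncnS_gt.
have t1 : 0 < 4 / e by rewrite divr_gt0.
have t2 : 0 < 8 / c ^+ 2 by rewrite divr_gt0.
have t3 : 0 < 8 * (1 + e) / (c ^+ 2 * e) by rewrite divr_gt0 ?mulr_gt0//; lra.
(* With this M, both 1/K = s r / M and d = r / M lie on the grid of centres, and w counts the grid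
   points of [-d, 1/K + d], both endpoints included. *)
pose M := (K * s * r)%N; pose w := (s * r + 2 * r + 1)%N.
have rR : 0 < r%:R :> R by rewrite /B in rB; lra.
have r0 : (0 < r)%N by rewrite -(ltr0n R).
have sn : (0 < s)%N by rewrite -(ltr0n R).
have M0 : (0 < M)%N by rewrite !muln_gt0 K0 sn.
have MR : 0 < M%:R :> R by rewrite ltr0n.
have Mr : r%:R <= M%:R :> R by rewrite ler_nat /M leq_pmull// muln_gt0 K0.
have ME : M%:R = K%:R * s%:R * r%:R :> R by rewrite /M !natrM.
have drM : d = r%:R / M%:R.
  by rewrite /d ME; field; rewrite !gt_eqF//; lra.
have wM : K%:R^-1 + (2 * r)%:R / M%:R + M%:R^-1 = w%:R / M%:R :> R.
  rewrite /w !natrD !natrM; field.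
  by rewrite !gt_eqF//; lra.
pose eta : R := 4 / c ^+ 2 / M%:R.
have iM : M%:R^-1 <= e / 4.
  rewrite -div1r ler_pdivrMr//.
  have : 4 < M%:R * e by rewrite -ltr_pdivrMr//; rewrite /B in rB; lra.
  lra.
have eta1 : eta <= 1 / 2.
  rewrite /eta ler_pdivrMr//.
  have : 4 / c ^+ 2 = 1 / 2 * (8 / c ^+ 2) by field; rewrite gt_eqF.
  rewrite /B in rB; nra.
have eta2 : eta * (1 + e) <= e / 2.
  rewrite /eta mulrAC ler_pdivrMr//.
  have -> : 4 / c ^+ 2 * (1 + e) = e / 2 * (8 * (1 + e) / (c ^+ 2 * e)).
    by field; rewrite !gt_eqF.
  rewrite ler_pM2l; last lra.
  rewrite /B in rB; lra.
have eta0 : 0 < 1 - eta by lra.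
pose f (a : 'I_M * 'I_M) : int := a.1%:Z - a.2%:Z.
pose S x : R[i] := \sum_(l < M | (l < w)%N) fejer M (x + r%:R / M%:R - l%:R / M%:R).
pose c' (a : 'I_M * 'I_M) : R[i] := (1 - eta)^-1%:C%C *
  \sum_(l < M | (l < w)%N) M%:R ^- 2 * cis ((f a)%:~R * (r%:R / M%:R - l%:R / M%:R)).
pose mu : R := (1 - eta)^-1 * #|[pred l : 'I_M | (l < w)%N]|%:R / M%:R.
have TS x : trig_sum c' f x = (1 - eta)^-1%:C%C * S x.
  rewrite /trig_sum /S; under [in RHS]eq_bigr do rewrite fejerE.
  rewrite exchange_big mulr_sumr /=; apply: eq_bigr => a _.
  rewrite /c' -mulrA mulr_suml; congr (_ * _); apply: eq_bigr => l _.
  by rewrite -mulrA -cisD -mulrDr [_ + x]addrC addrA.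
have ie0 : 0 < (1 - eta)^-1%:C%C :> R[i] by rewrite ltcR invr_gt0.
exists ('I_M * 'I_M)%type, f, c', mu; split.
- move=> x; rewrite TS mulr_ge0//; first exact: ltW.
  by apply: sumr_ge0 => l _; exact: fejer_ge0.
- move=> x xK; rewrite TS -(ler_pM2l (_ : 0 < (1 - eta)%:C%C)) ?ltcR// mulrA.
  have -> : (1 - eta)%:C%C * (1 - eta)^-1%:C%C = 1 :> R[i].
    by rewrite -rmorphM /= divff ?gt_eqF.
  rewrite mul1r mulr1 rmorphB /=.
  apply: (@fejer_arc M r w K%:R^-1 d c) => //; first by rewrite -drM.
  by rewrite -wM lerDl invr_ge0 ltW.
- rewrite /trig_mean (eq_bigr (fun=> ((1 - eta)^-1 * M%:R ^- 2 *
      #|[pred l : 'I_M | (l < w)%N]|%:R)%:C%C)); last first.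
    move=> a /eqP fa; rewrite /c' fa.
    under eq_bigr do rewrite mul0r cis0 mulr1.
    rewrite sumr_const -[_ *+ #|_|]mulr_natr [RHS]rmorphM [in RHS]rmorphM mulrA /=.
    congr (_ * _ * _).
      by rewrite [RHS]fmorphV /= rmorphXn /= rmorph_nat.
    by rewrite rmorph_nat.
  rewrite (eq_bigl (fun a => a.1 == a.2)); last first.
    by move=> a; rewrite /f subr_eq0.
  rewrite -(pair_big_dep xpredT (fun a b : 'I_M => a == b) (fun _ _ => (_ : R[i]))) /=.
  rewrite (eq_bigr (fun=> ((1 - eta)^-1 * M%:R ^- 2 *
      #|[pred l : 'I_M | (l < w)%N]|%:R)%:C%C)) => [|a _]; last first.
    by rewrite (big_pred1 a)// => b; rewrite /= eq_sym.
  rewrite sumr_const card_ord -rmorphMn /=; congr (_%:C%C).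
  rewrite /mu -[_ *+ M]mulr_natr; field.
  by rewrite !gt_eqF.
have nwR : #|[pred l : 'I_M | (l < w)%N]|%:R / M%:R <= w%:R / M%:R :> R.
  by rewrite ler_pM2r ?invr_gt0// ler_nat card_ord_lt.
have r2 : (2 * r)%:R / M%:R = 2 * d :> R by rewrite drM natrM mulrA.
rewrite /mu divr_ge0 ?mulr_ge0 ?invr_ge0 ?ler0n ?(ltW eta0)//=.
rewrite -mulrA mulrC ler_pdivrMr//; apply: (le_trans nwR); rewrite -wM r2.
(* The mean is at most (1/K + 2 d + 1/M) / (1 - eta), where 2 d + 1/M <= e/2 and eta (1/K + e) <=
   eta (1 + e) <= e/2. *)
have : K%:R^-1 <= 1 :> R by rewrite invf_le1//; lra.
have : 0 <= eta by rewrite !divr_ge0// ltW.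
nra.
Qed.

Lemma trig_sum_int (I : finType) (c : I -> R[i]) (f : I -> int) (x : R) (z : int) :
  trig_sum c f (x + z%:~R) = trig_sum c f x.
Proof.
by apply: eq_bigr => a _; rewrite mulrDr -intrM cisDint.
Qed.

(** Translating the arc majorant by a/K multiplies coefficients by phases that are 1 at frequency 0,
    so the mean is kept. All cells share the frequencies [f], as [weyl_prod] requires. *)
Lemma cell_majorant (K : nat) (e : R) : (0 < K)%N -> 0 < e ->
  exists (I : finType) (f : I -> int) (c : 'I_K -> I -> R[i]) (mu : R),
  [/\ forall a x, 0 <= trig_sum (c a) f x,
      forall (a : 'I_K) x, a%:R / K%:R <= x <= a.+1%:R / K%:R ->
        1 <= trig_sum (c a) f x,
      forall a, trig_mean (c a) f = mu%:C%C & 0 <= mu <= K%:R^-1 + e].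
Proof.
move=> K0 e0; have [I [f [c [mu [c_ge0 c_ge1 cmu mue]]]]] := @arc_majorant K e K0 e0.
pose c' (a : 'I_K) i := c i * cis ((f i)%:~R * - (a%:R / K%:R)).
have E a x : trig_sum (c' a) f x = trig_sum c f (x - a%:R / K%:R).
  by apply: eq_bigr => i _; rewrite /c' -mulrA -cisD -mulrDr [_ + x]addrC.
exists I, f, c', mu; split=> // [a x|a x /andP[x1 x2]|a].
- by rewrite E.
- rewrite E c_ge1// subr_ge0 x1 /= lerBlDl (le_trans x2)//.
  by rewrite -natr1 mulrDl mul1r.
- rewrite -cmu; apply: eq_bigr => i /eqP fi.
  by rewrite /c' fi mul0r cis0 mulr1.
Qed.

(** The product over the coordinates of the cell majorants serves as [g]: it dominates the indicator
    of the closed cell modulo 1, and [weyl_prod] evaluates its sums. *)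
Lemma weyl_cell_count (D : finType) (alpha gamma : D -> R) (K : nat) (e : R)
    (l : D -> 'I_K) :
  (forall k : D -> int, (exists z : int, \sum_i (k i)%:~R * alpha i = z%:~R) ->
     forall i, k i = 0) ->
  (0 < K)%N -> 0 < e ->
  exists (g : nat -> R) (C : R), [/\ forall n, 0 <= g n,
    forall n (v : D -> R),
      (forall i, (l i)%:R / K%:R <= v i <= (l i).+1%:R / K%:R) ->
      (forall i, exists z : int, v i = n%:R * alpha i + gamma i + z%:~R) ->
      1 <= g n &
    forall L : nat, \sum_(n < L) g n <= L%:R * (K%:R ^- #|D| + e) + C].
Proof.
move=> indep K0 e0.
(* The slack h per coordinate comes from continuity of (1/K + h)^q at h = 0. *)
have [h h0 he] : exists2 h : R, 0 < h & (K%:R^-1 + h) ^+ #|D| <= K%:R ^- #|D| + e.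
  move: #|D| => q.
  have : (K%:R^-1 + h) ^+ q @[h --> (0 : R)^'+] --> ((K%:R^-1 + 0) ^+ q : R).
    apply: (@cvg_comp _ _ _ (fun h : R => K%:R^-1 + h) (fun x : R => x ^+ q) _
      (nbhs (K%:R^-1 + 0 : R))); last exact: exprn_continuous.
    by apply: cvgD; [exact: cvg_cst|exact: cvg_at_right_filter cvg_id].
  move=> /cvgrPdist_le /(_ e e0) H.
  near (0:R)^'+ => h; exists h => //.
  have : `|(K%:R^-1 + 0) ^+ q - (K%:R^-1 + h) ^+ q| <= e by near: h.
  by rewrite addr0 exprVn ler_distlC => /andP[].
have [I [f [c [mu [c_ge0 c_ge1 cmu /andP[mu0 muh]]]]]] := @cell_majorant K h K0 h0.
have [C CP] := @weyl_prod R D I alpha gamma (fun i => c (l i)) f indep.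
pose G n : R[i] := \prod_i trig_sum (c (l i)) f (n%:R * alpha i + gamma i).
have G0 n : 0 <= G n by apply: prodr_ge0 => i _; exact: c_ge0.
have GE n : G n = (complex.Re (G n))%:C%C.
  by rewrite RRe_real// ger0_real.
exists (fun n => complex.Re (G n)), (complex.Re C); split.
- by move=> n; rewrite -lecR -GE.
- move=> n v vl vz; rewrite -lecR -GE.
  apply: (big_ind (fun y => 1 <= y)) => [//|y y' y1 y'1|i _]; first exact: mulr_ege1.
  have [z vE] := vz i.
  by rewrite -(@trig_sum_int _ _ _ _ z) -vE c_ge1.
move=> L; have := CP L.
have -> : \prod_i trig_mean (c (l i)) f = (mu ^+ #|D|)%:C%C.
  by rewrite (eq_bigr (fun=> mu%:C%C)) ?prodr_const ?rmorphXn// => i _; exact: cmu.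
have -> : \sum_(n < L) \prod_i trig_sum (c (l i)) f (n%:R * alpha i + gamma i)
   = (\sum_(n < L) complex.Re (G n))%:C%C.
  by rewrite rmorph_sum; apply: eq_bigr => n _; exact: GE.
rewrite -[L%:R](rmorph_nat (real_complex R)) -rmorphM -rmorphB /= => H.
(* In [R[i]] the order compares real parts of numbers with equal imaginary parts; the real number on
   the left is below its norm, hence below C. *)
have H2 : (\sum_(n < L) complex.Re (G n) - L%:R * mu ^+ #|D|)%:C%C <= C.
  by apply: le_trans H; rewrite real_ler_norm// complex_real.
move: H2; rewrite lecE /= => /andP[_]; rewrite lerBlDl => H2.
apply: (le_trans H2); rewrite lerD2r ler_wpM2l//; apply: le_trans he.
by rewrite lerXn2r// ?nnegrE// (le_trans mu0).
Unshelve. all: by end_near.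
Qed.
End Majorant.

(** * Large houses *)

(* At the time t = (s_j + beta - 1) / p_j at which party j gets its last seat, these
   are the numbers V_i of the limit law. *)
Definition gaps {R : realType} {m : nat} (p : 'I_m -> R) (beta : R)
    (s : 'I_m -> nat) (j i : 'I_m) : R :=
  ((s j)%:R + beta - 1) / p j * p i - beta + 1 - (s i)%:R.

(** For [v] given by [zeroed_at U J] this is [limit_joint], so the houses and the limit are compared
    through the same map. *)
Definition excess_of_gaps {R : realType} {m : nat} (p : 'I_m -> R) (beta : R)
    (v : 'I_m -> R) (i : 'I_m) : R :=
  p i * \sum_j v j - v i + (beta - 1) * (m%:R * p i - 1).

Section Allocation.
Context {R : realType} {m : nat} (p : 'I_m -> R) (beta : R).
Hypothesis p_gt0 : forall i, 0 < p i.
Hypothesis p_sum : \sum_i p i = 1.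

(** The party j is one whose last seat comes latest, at time [tau j] <= 1/D. The maximality of
    [tau j] gives nonnegative gaps, and [tau j] <= 1/D with the rounding bound gives gaps at most 1.
    Summing the gaps expresses [tau j] through N. *)
Lemma allocation_gaps : exists n0 : nat, forall N s,
  (n0 <= N)%N -> divisor_allocation p beta N s -> exists j,
  [/\ forall i, 0 <= gaps p beta s j i <= 1, gaps p beta s j j = 0 &
      forall i, seat_excess p N s i = excess_of_gaps p beta (gaps p beta s j) i].
Proof.
(* The first term bounds N - 1/D; the second then forces |beta| <= p_i / D for every i, so that the
   maximum with 0 is inactive. *)
pose b := m%:R * (`|beta| + 1) + \sum_i `|beta| / p i.
exists (Num.truncn b).+1 => N s n0N [D D0 [[r rP sP] sN]].
have bN : b <= N%:R.
  by apply: ltW; apply: (lt_le_trans (truncnS_gt b)); rewrite ler_nat.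
have t0 : 0 < D^-1 by rewrite invr_gt0.
have sum_s : \sum_i (s i)%:R = N%:R :> R by rewrite -natr_sum sN.
have s_le i : (s i)%:R <= p i / D + (`|beta| + 1).
  have pD : 0 < p i / D by rewrite divr_gt0.
  have nb := ler_norm (- beta); rewrite normrN in nb.
  have /andP[_ r2] := rP i.
  have -> : (s i)%:R = (Num.max (r i) 0)%:~R :> R by rewrite -sP.
  by rewrite maxEle; case: ifP => _; rewrite ?mulr0z; have := normr_ge0 beta; lra.
have ND : N%:R <= D^-1 + m%:R * (`|beta| + 1).
  rewrite -sum_s; apply: (le_trans (ler_sum _ (fun i _ => s_le i))).
  by rewrite big_split /= -mulr_suml p_sum mul1r sumr_const card_ord mulr_natl.
have sr i : (s i)%:R = (r i)%:~R :> R.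
  have -> : (s i)%:R = (Num.max (r i) 0)%:~R :> R by rewrite -sP.
  suff r0 : 0 <= r i by rewrite max_l.
  rewrite -(ler0z R); have /andP[r1 _] := rP i; apply: le_trans r1.
  have : `|beta| / p i <= D^-1.
    have : `|beta| / p i <= \sum_i `|beta| / p i.
      rewrite (bigD1 i)//= lerDl sumr_ge0// => k _.
      by rewrite divr_ge0// ltW.
    by rewrite /b in bN; lra.
  by rewrite ler_pdivrMr// subr_ge0 mulrC; apply: le_trans; exact: ler_norm.
have i0 : 'I_m.
  case: m p p_sum => [q|n _ _]; last exact: ord0.
  by rewrite big_ord0 => /esym/eqP; rewrite oner_eq0.
pose tau j := ((s j)%:R + beta - 1) / p j.
have [j _ jP] := @Order.TotalTheory.arg_maxP _ _ _ i0 xpredT tau isT.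
have sj i : (s i)%:R = p i * tau i - beta + 1 by rewrite /tau; field; rewrite gt_eqF.
have tauD : tau j <= D^-1.
  rewrite /tau ler_pdivrMr// sr; have /andP[_ r2] := rP j.
  by move: r2; rewrite [p j / D]mulrC; lra.
have gE i : gaps p beta s j i = tau j * p i - beta + 1 - (s i)%:R by [].
have gj : gaps p beta s j j = 0 by rewrite gE (sj j); ring.
exists j; split => // i.
- rewrite gE; apply/andP; split.
    have H : p i * tau i <= p i * tau j by rewrite ler_pM2l//; exact: jP.
    by rewrite sj [_ * p i]mulrC; lra.
  have /andP[r1 _] := rP i; rewrite -sr in r1.
  have : tau j * p i <= p i / D by rewrite mulrC ler_pM2l.
  by lra.
have sumg : \sum_i gaps p beta s j i = tau j + m%:R * (1 - beta) - N%:R.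
  under eq_bigr do rewrite gE.
  rewrite sumrB sum_s; congr (_ - _).
  rewrite (eq_bigr (fun i => tau j * p i + (1 - beta))); last by move=> k _; ring.
  by rewrite big_split /= -mulr_sumr p_sum mulr1 sumr_const card_ord mulr_natl.
rewrite /seat_excess /excess_of_gaps sumg gE; ring.
Qed.

(** It keeps the excesses in a fixed box, where test functions are uniformly continuous, and bounds
    |s_j - N p_j| when the jumps of party j are counted. *)
Lemma excess_bound (v : 'I_m -> R) i : (forall i, 0 <= v i <= 1) ->
  `|excess_of_gaps p beta v i| <= m%:R + 1 + `|beta - 1| * (m%:R + 1).
Proof.
move=> v01; rewrite /excess_of_gaps.
have pi1 : p i <= 1.
  by rewrite -p_sum (bigD1 i)//= lerDl sumr_ge0// => k _; exact: ltW.
have pi0 := p_gt0 i.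
have S0 : 0 <= \sum_j v j by rewrite sumr_ge0// => k _; case/andP: (v01 k).
have Sm : \sum_j v j <= m%:R.
  rewrite -[m in leRHS]card_ord -sumr_const; apply: ler_sum => k _.
  by case/andP: (v01 k).
have /andP[v0 v1] := v01 i.
have m0 : 0 <= m%:R :> R by [].
apply: (le_trans (ler_normD _ _)); apply: lerD.
  apply: (le_trans (ler_normB _ _)); apply: lerD.
    rewrite ger0_norm ?mulr_ge0 ?(ltW pi0)//.
    by apply: le_trans Sm; rewrite ler_piMl.
  by rewrite ger0_norm.
rewrite normrM ler_wpM2l//; apply: (le_trans (ler_normB _ _)).
rewrite normr1 lerD2r ger0_norm ?mulr_ge0 ?(ltW pi0)//.
by rewrite ler_piMr.
Qed.

(* Two parties with incommensurable shares reach a jump simultaneously at most once. *)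
Lemma eventually_no_tie : rat_independent p -> exists n0 : nat, forall n i j,
  (n0 <= n)%N -> i != j ->
  ~ exists z : int, (n%:R + beta - 1) / p j * p i - beta = z%:~R.
Proof.
move=> indep.
suff /choice[n0 n0P] : forall ij : 'I_m * 'I_m, exists n0 : nat, forall n,
    (n0 <= n)%N -> ij.1 != ij.2 ->
    ~ exists z : int, (n%:R + beta - 1) / p ij.2 * p ij.1 - beta = z%:~R.
  exists (\max_ij n0 ij)%N => n i j nn ij.
  by apply: (n0P (i, j)) => //; apply: leq_trans nn; exact: (leq_bigmax (i, j)).
move=> [i j] /=.
have [[a [z az]]|no] := pselect (exists a : nat, exists z : int,
    (a%:R + beta - 1) / p j * p i - beta = z%:~R); last first.
  by exists 0%N => n _ _ [z nz]; apply: no; exists n, z.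
exists a.+1 => n an ij [y ny].
have pj0 : p j != 0 by rewrite gt_eqF.
have E : (n%:R - a%:R) * p i - (y%:~R - z%:~R) * p j = 0.
  by rewrite -ny -az; field.
(* Two ties, at a and at n > a, subtract to the rational relation (n - a) p_i = (y - z) p_j, whose
   coefficient at i is nonzero. *)
pose c k : rat := if k == i then n%:R - a%:R else if k == j then - (y%:~R - z%:~R) else 0.
have : c i = 0.
  apply: indep; rewrite (bigD1 i)//= (bigD1 j) 1?eq_sym//= big1.
    rewrite /c eqxx eq_sym (negbTE ij) eqxx addr0 rmorphN !rmorphB /=.
    by rewrite !ratr_nat !ratr_int mulNr.
  by move=> k /andP[ki kj]; rewrite /c (negbTE ki) (negbTE kj) rmorph0 mul0r.
rewrite /c eqxx => /eqP; rewrite subr_eq0 eqr_nat => /eqP na.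
by rewrite na ltnn in an.
Qed.

(** Once [s j] is fixed, the gap of i is a fixed number minus [s i]. Two values of [s i] can both
    leave it in [0, 1] only if that number is an integer, which is a tie. *)
Lemma gaps_inj (s s' : 'I_m -> nat) (j : 'I_m) :
  s j = s' j ->
  (forall i, 0 <= gaps p beta s j i <= 1) ->
  (forall i, 0 <= gaps p beta s' j i <= 1) ->
  (forall i, i != j -> ~ exists z : int,
     ((s j)%:R + beta - 1) / p j * p i - beta = z%:~R) ->
  s =1 s'.
Proof.
move=> sj g01 g01' notie i; have [->//|ij] := eqVneq i j.
have := g01 i; have := g01' i; rewrite /gaps -sj.
have := notie i ij; set y := _ - beta => ny {notie g01 g01'}.
have strict (a b : nat) : (a < b)%N -> 0 <= y + 1 - b%:R -> y + 1 - a%:R <= 1 -> False.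
  rewrite -(ler_nat R) -natr1 => ab b0 a1; apply: ny; exists a%:Z.
  by rewrite -pmulrn; apply/eqP; rewrite eq_le; apply/andP; split; lra.
move=> /andP[a1 a2] /andP[b1 b2].
by have [lt|lt|//] := ltngtP (s i) (s' i); [case: (strict _ _ lt)|case: (strict _ _ lt)].
Qed.
End Allocation.

(** * Expectations and step functions *)

Section StepFunctions.
Context {R : realType} {d : measure_display} {T : measurableType d} (P : probability T R).

Lemma bounded_integrable (Y : T -> R) (B : R) :
  measurable_fun setT Y -> (forall w, `|Y w| <= B) -> P.-integrable setT (EFin \o Y).
Proof.
move=> mY YB; apply: measurable_bounded_integrable => //.
  by rewrite (le_lt_trans (probability_le1 _ _))// ltry.
by exists B; split; [exact: num_real|move=> x Bx w _ /=; exact: le_trans (YB w) (ltW Bx)].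
Qed.

Lemma step_integrable (I : finType) (A : I -> set T) (c : I -> R) :
  (forall i, measurable (A i)) ->
  P.-integrable setT (EFin \o (fun w => \sum_i c i * \1_(A i) w)).
Proof.
move=> mA; apply: (@bounded_integrable _ (\sum_i `|c i|)).
  by apply: measurable_sum => i; apply: measurable_funM => //; exact: measurable_indic.
move=> w; apply: (le_trans (ler_norm_sum _ _ _)); apply: ler_sum => i _.
rewrite normrM ler_piMr// indicE.
by case: (_ \in _); rewrite ?normr1 ?normr0 ?ler01.
Qed.

Lemma Rintegral_step (I : finType) (A : I -> set T) (c : I -> R) (b : R) :
  (forall i, measurable (A i)) ->
  \int[P]_w (\sum_i c i * \1_(A i) w + b) = \sum_i c i * fine (P (A i)) + b.
Proof.
move=> mA; rewrite RintegralD//; last 2 first.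
- exact: step_integrable.
- by apply: (@bounded_integrable _ `|b|) => //; exact: measurable_cst.
rewrite Rintegral_cst//= probability_setT mulr1; congr (_ + _).
have int1 i : P.-integrable setT (EFin \o \1_(A i)).
  apply: (@bounded_integrable _ 1); first exact: measurable_indic.
  by move=> w; rewrite indicE; case: (_ \in _); rewrite ?normr1 ?normr0.
have E i : (\int[P]_w (c i * \1_(A i) w)%:E = (c i * fine (P (A i)))%:E)%E.
  rewrite [LHS](@integralZl _ _ _ P setT _ (EFin \o \1_(A i)) _ (c i))//.
  have -> : (\int[P]_w (EFin \o \1_(A i)) w)%E = P (A i).
    by rewrite -[in RHS](setIT (A i)); exact: integral_indic.
  by rewrite EFinM fineK// fin_num_measure.
rewrite /Rintegral; under eq_integral do rewrite -sumEFin.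
rewrite integral_sum// => [|i].
  rewrite (eq_bigr (fun i => (c i * fine (P (A i)))%:E)) ?sumEFin//.
rewrite (_ : (fun _ => _) = (fun w => (c i)%:E * (EFin \o \1_(A i)) w)%E).
  exact: integrableZl.
by apply/funext => w; rewrite EFinM.
Qed.

(** Inequalities between finite sums of probabilities follow by integrating pointwise inequalities
    of step functions. *)
Lemma step_le (I K : finType) (A : I -> set T) (B : K -> set T) (a : I -> R) (b : K -> R) :
  (forall i, measurable (A i)) -> (forall k, measurable (B k)) ->
  (forall w, \sum_i a i * \1_(A i) w <= \sum_k b k * \1_(B k) w) ->
  \sum_i a i * fine (P (A i)) <= \sum_k b k * fine (P (B k)).
Proof.
move=> mA mB AB; rewrite -[leLHS]addr0 -[leRHS]addr0 -!Rintegral_step//.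
by under eq_Rintegral do rewrite addr0; under [leRHS]eq_Rintegral do rewrite addr0;
  apply: le_Rintegral => //; exact: step_integrable.
Qed.

Lemma cover_le (K : finType) (A : set T) (B : K -> set T) :
  measurable A -> (forall k, measurable (B k)) ->
  (forall w, A w -> exists k, B k w) ->
  fine (P A) <= \sum_k fine (P (B k)).
Proof.
move=> mA mB AB.
have unitE (F : unit -> R) : \sum_i F i = F tt.
  by rewrite (bigD1 tt)//= big1 ?addr0// => -[].
have := @step_le unit K (fun=> A) B (fun=> 1) (fun=> 1) (fun=> mA) mB.
rewrite unitE mul1r (eq_bigr (fun k => fine (P (B k)))) => [|k _]; last by rewrite mul1r.
apply=> w; rewrite unitE mul1r (eq_bigr (fun k => \1_(B k) w)) => [|k _]; last by rewrite mul1r.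
rewrite indicE; have [Aw|_] := boolP (w \in A); last first.
  by apply: sumr_ge0 => k _; rewrite indicE.
have [k Bk] := AB w (set_mem Aw).
rewrite (bigD1 k)//= indicE mem_set// lerDl.
by apply: sumr_ge0 => h _; rewrite indicE.
Qed.

Lemma disjoint_le (K : finType) (Q : pred K) (A : K -> set T) (B : set T) :
  (forall k, measurable (A k)) -> measurable B ->
  (forall k k' w, A k w -> A k' w -> k = k') ->
  (forall k, Q k -> A k `<=` B) ->
  \sum_(k | Q k) fine (P (A k)) <= fine (P B).
Proof.
move=> mA mB triv AB.
have unitE (F : unit -> R) : \sum_i F i = F tt.
  by rewrite (bigD1 tt)//= big1 ?addr0// => -[].
have := @step_le K unit A (fun=> B) (fun k => (Q k)%:R) (fun=> 1) mA (fun=> mB).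
rewrite unitE mul1r => H; rewrite [leLHS]big_mkcond.
rewrite (eq_bigr (fun k => (Q k)%:R * fine (P (A k)))) => [|k _]; last first.
  by case: (Q k); rewrite ?mul1r ?mul0r.
apply: H => w; rewrite unitE mul1r indicE.
have [[k [Qk Ak]]|no] := pselect (exists k, Q k /\ A k w).
  rewrite mem_set; last exact: AB Ak.
  rewrite (bigD1 k)//= Qk mul1r indicE mem_set// big1 ?addr0// => k' k'k.
  rewrite indicE memNset ?mulr0// => Ak'; move/eqP: k'k; apply.
  exact: triv Ak' Ak.
rewrite big1 ?ler0n// => k _; rewrite indicE.
have [Ak|_] := boolP (w \in A k); last by rewrite mulr0.
rewrite inE in Ak; case Qk : (Q k); last by rewrite mul0r.
by case: no; exists k.
Qed.

(** The error is e on the events [A i], and C on the rest of the space, whose mass is 1 - \sum_i P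
    (A i). *)
Lemma expectation_step_dist (Y : T -> R) (C e : R) (I : finType) (A : I -> set T) (y : I -> R) :
  measurable_fun setT Y -> (forall w, `|Y w| <= C) ->
  (forall i, measurable (A i)) ->
  (forall i j w, A i w -> A j w -> i = j) ->
  (forall i w, A i w -> `|Y w - y i| <= e) -> 0 <= e ->
  ('E_P[Y] = (fine 'E_P[Y])%:E)%E /\
  `|fine 'E_P[Y]%E - \sum_i y i * fine (P (A i))|
    <= e + C * (1 - \sum_i fine (P (A i))).
Proof.
move=> mY YC mA triv Yy e0.
have intY := @bounded_integrable _ _ mY YC.
rewrite unlock; split; first by rewrite fineK// integrable_fin_num.
have C0 : 0 <= C by apply: (le_trans (normr_ge0 _) (YC point)).
have sum1 (c : I -> R) w i : A i w -> \sum_i c i * \1_(A i) w = c i.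
  move=> Aw; rewrite (bigD1 i)//= indicE mem_set// mulr1 big1 ?addr0// => k ki.
  rewrite indicE memNset ?mulr0// => Ak; move/eqP: ki; apply.
  exact: triv Ak Aw.
have sum0 (c : I -> R) w : (forall i, ~ A i w) -> \sum_i c i * \1_(A i) w = 0.
  by move=> Aw; rewrite big1// => k _; rewrite indicE memNset ?mulr0.
have int c b : P.-integrable setT (EFin \o (fun w => \sum_i c i * \1_(A i) w + b)).
  apply: (@integrableD _ _ _ P setT measurableT
    (EFin \o (fun w => \sum_i c i * \1_(A i) w)) (EFin \o cst b)).
    exact: step_integrable.
  by apply: (@bounded_integrable _ `|b|) => //; exact: measurable_cst.
(* The integrand on the right equals y_i + e on [A i] and C + e off all the events. *)
have up : \int[P]_w Y w <= \sum_i (y i - C) * fine (P (A i)) + (C + e).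
  rewrite -Rintegral_step//; apply: le_Rintegral => // w _.
  have [[i Aw]|no] := pselect (exists i, A i w).
    by rewrite (sum1 _ _ i)//; have := Yy i w Aw; rewrite ler_distl => /andP[_]; lra.
  rewrite sum0 => [|i Aw]; last by apply: no; exists i.
  by have := YC w; rewrite ler_norml => /andP[_]; lra.
have lo : \sum_i (y i + C) * fine (P (A i)) - (C + e) <= \int[P]_w Y w.
  rewrite -Rintegral_step//; apply: le_Rintegral => // w _.
  have [[i Aw]|no] := pselect (exists i, A i w).
    by rewrite (sum1 _ _ i)//; have := Yy i w Aw; rewrite ler_distl => /andP[]; lra.
  rewrite sum0 => [|i Aw]; last by apply: no; exists i.
  by have := YC w; rewrite ler_norml => /andP[]; lra.
move: up lo; under eq_bigr do rewrite mulrBl.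
under [in X in _ -> X -> _]eq_bigr do rewrite mulrDl.
rewrite sumrB big_split /= -!mulr_sumr ler_distl => up lo.
by apply/andP; split; rewrite /Rintegral /= in up lo *; lra.
Qed.
End StepFunctions.

(** * Continuous functions of rows: uniform continuity and measurability *)

Section RowFunctions.
Context {R : realType} {m : nat}.
Implicit Types (f : 'rV[R]_m -> R) (x y : 'I_m -> R).

Lemma row_ball (u v : 'rV[R]_m) (e : R) : 0 < e ->
  (forall i, `|u ord0 i - v ord0 i| < e) -> ball u e v.
Proof. by move=> e0 uv; split=> // i j; rewrite (ord1 i); exact: uv. Qed.

(** Heine's theorem on a compact box, in a form where only [x] is confined to the box; the
    near-covering form of compactness yields a common radius. *)
Lemma continuous_row_unif f (C e : R) : continuous f -> 0 < e ->
  exists2 delta : R, 0 < delta & forall x y, (forall i, `|x i| <= C) ->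
    (forall i, `|x i - y i| < delta) -> `|f (\row_i x i) - f (\row_i y i)| <= e.
Proof.
move=> fc e0.
pose K := [set v : 'rV[R]_m | forall i, v ord0 i \in `[- C, C]].
have /compact_near_coveringP Kc : compact K.
  apply: (@rV_compact _ _ (fun=> `[- C, C]%classic)) => _; exact: segment_compact.
have := Kc R (0 : R)^'+ (fun d u => forall v, ball u d v -> `|f u - f v| <= e) _.
case.
  move=> u _; have /cvgrPdist_le/(_ (e / 2)) := fc u.
  rewrite divr_gt0// => /(_ isT)/nbhs_ballP[r /= r0 ru].
  exists (ball u (r / 2), [set d : R | d < r / 2]) => /=.
    by split; [apply: nbhsx_ballx|apply: nbhs_right_lt]; rewrite divr_gt0.
  move=> [u' d] [/= uu' dr] v u'v.
  have uv : ball u r v.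
    rewrite (splitr r); apply: ball_triangle uu' _.
    exact: (le_ball (ltW dr)).
  have uu'' : ball u r u' by apply: (le_ball _ uu'); lra.
  have : `|f u - f v| <= e / 2 by exact: (ru _ uv).
  have : `|f u - f u'| <= e / 2 by exact: (ru _ uu'').
  rewrite !ler_distl => /andP[? ?] /andP[? ?].
  by apply/andP; split; lra.
move=> r /= r0 rP; exists (r / 2); first exact: divr_gt0.
move=> x y xC xy; apply: (rP (r / 2)).
- by rewrite /= sub0r normrN ger0_norm; lra.
- by lra.
- by move=> i; rewrite mxE in_itv /= -ler_norml.
- by apply: row_ball; [lra|move=> i; rewrite !mxE].
Qed.
End RowFunctions.

Section CountableMeasurability.
Context {d : measure_display} {T : measurableType d}.

Lemma countable_preimage_measurable (C : countType) (Z : T -> C) :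
  (forall c, measurable (Z @^-1` [set c])) -> forall A : set C, measurable (Z @^-1` A).
Proof.
move=> mZ A; rewrite (_ : _ @^-1` _ = \bigcup_(c in A) (Z @^-1` [set c])).
  rewrite bigcup_mkcond; apply: countable_bigcupT_measurable; first exact: countableP.
  by move=> c; case: ifP.
by apply/seteqP; split => [w ZA|w [c Ac /= Zc]]; [by exists (Z w)|by rewrite /= Zc].
Qed.

Lemma ffun_preimage_measurable (I : finType) (C : countType) (Z : I -> T -> C) :
  (forall i c, measurable (Z i @^-1` [set c])) ->
  forall c : {ffun I -> C}, measurable ((fun w => [ffun i => Z i w]) @^-1` [set c]).
Proof.
move=> mZ c; rewrite (_ : _ @^-1` _ = \bigcap_(i in [set: I]) (Z i @^-1` [set c i])).
  by apply: fin_bigcap_measurable => // i _; exact: mZ.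
apply/seteqP; split => [w <- i _|w Zc]; first by rewrite /= ffunE.
by apply/ffunP => i; rewrite ffunE; exact: Zc.
Qed.

(* [f] of a random row is the pointwise limit of [f] evaluated at the row rounded
   down to the grid [n.+1^-1 Z], which takes countably many values. *)
Lemma continuous_row_measurable {R : realType} {m : nat} (f : 'rV[R]_m -> R)
    (Y : 'I_m -> T -> R) :
  continuous f -> (forall i, measurable_fun setT (Y i)) ->
  measurable_fun setT (fun w => f (\row_i Y i w)).
Proof.
move=> fc mY.
pose fl n i w : int := Num.floor (n.+1%:R * Y i w).
have mfl n i c : measurable (fl n i @^-1` [set c]).
  rewrite (_ : _ @^-1` _ = setT `&`
      (fun w => n.+1%:R * Y i w) @^-1` `[c%:~R, (c + 1)%:~R[%classic).
    by apply: measurable_funM => //; exact: measurable_cst.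
  rewrite setTI; apply/seteqP; split => w /=; rewrite in_itv /= /fl.
    by move=> <-; rewrite floor_le_tmp floorD1_gt.
  exact: floor_def.
pose h n w := f (\row_i ((fl n i w)%:~R / n.+1%:R)).
apply: (@measurable_fun_cvg _ _ _ _ h) => [n|w _].
  move=> _ A mA; rewrite setTI.
  have := countable_preimage_measurable _ _ (ffun_preimage_measurable _ _ _ (mfl n)).
  move=> /(_ [set c : {ffun 'I_m -> int} | A (f (\row_i ((c i)%:~R / n.+1%:R)))]).
  congr measurable; apply/seteqP; split => v /=;
    by under eq_mx do rewrite ffunE.
apply: (@cvg_comp _ _ _ (fun n => \row_i ((fl n i w)%:~R / n.+1%:R)) f _
  (nbhs (\row_i Y i w))); last exact: fc.
apply/cvg_ballP => e e0; near=> n; apply: row_ball => // i; rewrite !mxE.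
have n0 : 0 < n.+1%:R :> R by [].
have -> : Y i w - (fl n i w)%:~R / n.+1%:R =
    (n.+1%:R * Y i w - (fl n i w)%:~R) / n.+1%:R by field; rewrite gt_eqF.
have f1 : (fl n i w)%:~R <= n.+1%:R * Y i w by exact: floor_le_tmp.
have := floorD1_gt (n.+1%:R * Y i w); rewrite -/(fl n i w) intrD => f2.
rewrite ger0_norm; last by rewrite divr_ge0// subr_ge0.
have : n.+1%:R^-1 < e by near: n; exact: near_infty_natSinv_lt (PosNum e0).
apply: le_lt_trans; rewrite ler_pdivrMr// mulVf ?gt_eqF//; lra.
Unshelve. all: by end_near.
Qed.
End CountableMeasurability.

(** * Cells and the law of the gaps *)

(** The probability of the cell l of side 1/K for a random vector whose j-th entry is 0 and whose
    other entries are independent and uniform on (0, 1). *)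
Definition face_weight {R : realType} {m K : nat} (j : 'I_m) (l : 'I_m -> 'I_K) : R :=
  \prod_i (if i == j then (nat_of_ord (l i) == 0%N)%:R else K%:R^-1).

(** The same for a mixture: the vanishing entry is j with probability [q j]. Both [p] and
    [split_weight] occur as [q]. *)
Definition cell_weight {R : realType} {m K : nat} (q : 'I_m -> R) (l : 'I_m -> 'I_K) : R :=
  \sum_j q j * face_weight j l.

Definition corner {R : realType} {m K : nat} (l : 'I_m -> 'I_K) (i : 'I_m) : R :=
  (l i)%:R / K%:R.

Section Cells.
Context {R : realType} {m : nat}.

Lemma face_weightE K (j : 'I_m) (l : 'I_m -> 'I_K) :
  face_weight j l = (nat_of_ord (l j) == 0%N)%:R * K%:R ^- m.-1 :> R.
Proof.
rewrite /face_weight (bigD1_ord j)//= eqxx; congr (_ * _).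
rewrite (eq_bigr (fun=> K%:R^-1)) => [|k _]; last by rewrite eq_sym (negbTE (neq_lift _ _)).
by rewrite prodr_const card_ord exprVn.
Qed.

Lemma face_weight_ge0 K (j : 'I_m) (l : 'I_m -> 'I_K) : 0 <= face_weight j l :> R.
Proof. by rewrite face_weightE mulr_ge0// invr_ge0 exprn_ge0. Qed.

Lemma sum_face_weight K (j : 'I_m) : (0 < K)%N ->
  \sum_(l : {ffun 'I_m -> 'I_K}) face_weight j l = 1 :> R.
Proof.
move=> K0; rewrite /face_weight -(bigA_distr_bigA (fun i (a : 'I_K) =>
  if i == j then (nat_of_ord a == 0%N)%:R else K%:R^-1 : R)) /= big1// => i _.
case: eqP => _; last first.
  by rewrite sumr_const card_ord -[_ *+ K]mulr_natl divff// pnatr_eq0 -lt0n.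
rewrite (bigD1 (Ordinal K0))//= big1 ?addr0// => a.
by rewrite -val_eqE /= => /negbTE ->.
Qed.

Lemma sum_cell_weight K (q : 'I_m -> R) : (0 < K)%N -> \sum_j q j = 1 ->
  \sum_(l : {ffun 'I_m -> 'I_K}) cell_weight q l = 1.
Proof.
move=> K0 q1; rewrite /cell_weight exchange_big /= -q1; apply: eq_bigr => j _.
by rewrite -mulr_sumr sum_face_weight ?mulr1.
Qed.

(** Cells are closed: the point 1 goes to the last one, and 0 has to go to the first, where
    [face_weight] does not vanish. *)
Lemma unit_interval_cell K (x : R) : (0 < K)%N -> 0 <= x <= 1 ->
  exists a : 'I_K, a%:R / K%:R <= x <= a.+1%:R / K%:R /\ (x = 0 -> a = 0%N :> nat).
Proof.
move=> K0 /andP[x0 x1]; have KR : 0 < K%:R :> R by rewrite ltr0n.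
have [xlt1|xge1] := ltP x 1; last first.
  have aK : (K.-1 < K)%N by rewrite prednK.
  exists (Ordinal aK) => /=; split; last by move=> x00; move: xge1; rewrite x00 ler10.
  rewrite prednK// divff ?gt_eqF// x1 andbT ler_pdivrMr//.
  apply: (@le_trans _ _ K%:R); last by rewrite ler_peMl// ltW.
  by rewrite ler_nat leq_pred.
have aK : (Num.truncn (K%:R * x) < K)%N.
  by rewrite truncn_lt_nat ?mulr_ge0 ?(ltW KR)// gtr_pMr.
exists (Ordinal aK) => /=; split; last by move=> ->; rewrite mulr0 truncn0.
rewrite ler_pdivrMr// ler_pdivlMr// mulrC truncn_le ?mulr_ge0 ?(ltW KR)//=.
exact/ltW/truncnS_gt.
Qed.
End Cells.

Definition in_cell {R : realType} {m K : nat} (p : 'I_m -> R) (beta : R)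
    (N : nat) (s : 'I_m -> nat) (j : 'I_m) (l : 'I_m -> 'I_K) : Prop :=
  [/\ forall i, 0 <= gaps p beta s j i <= 1, gaps p beta s j j = 0,
      forall i, seat_excess p N s i = excess_of_gaps p beta (gaps p beta s j) i,
      forall i, (l i)%:R / K%:R <= gaps p beta s j i <= (l i).+1%:R / K%:R &
      l j = 0%N :> nat].

(** * Counting the houses whose gaps lie in a given cell *)

Section HouseSide.
Context {R : realType} {m : nat} (p : 'I_m -> R) (beta : R).
Hypothesis p_gt0 : forall i, 0 < p i.
Hypothesis p_sum : \sum_i p i = 1.
Hypothesis p_indep : rat_independent p.

(** Multiplied by p_j, the relation becomes a rational one between the shares, with coefficient -z
    at j. *)
Lemma share_ratio_independent (j : 'I_m) (k : 'I_m.-1 -> int) :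
  (exists z : int, \sum_i (k i)%:~R * (p (lift j i) / p j) = z%:~R) ->
  forall i, k i = 0.
Proof.
move=> [z kz] i.
pose c h : rat := if unlift j h is Some i' then (k i')%:~R else - z%:~R.
have : c (lift j i) = 0.
  apply: p_indep; rewrite (bigD1_ord j)//= /c unlift_none rmorphN /= ratr_int -kz.
  rewrite mulNr mulr_suml addrC; apply/eqP; rewrite subr_eq0; apply/eqP.
  apply: eq_bigr => h _; rewrite liftK ratr_int -mulrA divfK// gt_eqF//.
by rewrite /c liftK => /eqP; rewrite intr_eq0 => /eqP.
Qed.

(** The event is split by the value n of s_j. Without ties n determines the house, so each piece has
    probability at most 1/N0, and a nonempty piece has [g n] >= 1. About N0 p_j values of n occur,
    and [weyl_cell_count] sums [g] over them. *)
Lemma jump_cell_bound (K : nat) (j : 'I_m) (l : 'I_m -> 'I_K) (e : R) :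
  (0 < K)%N -> 0 < e -> exists (n1 : nat) (C : R),
  forall (N0 : nat) d (T : measurableType d) (P : probability T R)
    (N : {RV P >-> nat}) (s : 'I_m -> {RV P >-> nat}) (A : set T),
  (0 < N0)%N -> uniform_upto P N0 N -> measurable A ->
  (forall w, A w -> (n1 <= N w <= N0)%N /\
     in_cell p beta (N w) (fun i => s i w) j l) ->
  fine (P A) <= p j * face_weight j l + e + C / N0%:R.
Proof.
move=> K0 e0.
pose al (k : 'I_m.-1) := p (lift j k) / p j.
pose ga (k : 'I_m.-1) := (beta - 1) * al k - beta.
have [g [Cg [g0 g1 gL]]] :=
  @weyl_cell_count R _ al ga K e (fun k => l (lift j k)) (@share_ratio_independent j) K0 e0.
have [n0 notie] := eventually_no_tie p beta p_gt0 p_indep.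
pose Cb : R := m%:R + 1 + `|beta - 1| * (m%:R + 1).
have pj0 := p_gt0 j.
have pj1 : p j <= 1.
  by rewrite -p_sum (bigD1 j)//= lerDl sumr_ge0// => k _; exact: ltW.
have Cb0 : 0 <= Cb by rewrite /Cb addr_ge0 ?mulr_ge0 ?addr_ge0.
(* Beyond this size N p_j - Cb >= n0, hence s_j >= n0, where ties are excluded. *)
exists (Num.truncn ((n0%:R + Cb) / p j)).+1.
(* The range of s_j exceeds N0 p_j by at most Cb + 1, each unit costing at most 1 + e; [Cg] is the
   error of the Weyl sums. *)
exists ((Cb + 1) * (1 + e) + `|Cg|) => N0 d T P N s A N00 Nunif mA AP.
have N0R : 0 < N0%:R :> R by rewrite ltr0n.
have rest0 : 0 <= e + ((Cb + 1) * (1 + e) + `|Cg|) / N0%:R.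
  by rewrite addr_ge0 ?(ltW e0)// divr_ge0// addr_ge0// mulr_ge0 ?addr_ge0// ltW.
have PA0 : A = set0 -> fine (P A) <=
    p j * face_weight j l + e + ((Cb + 1) * (1 + e) + `|Cg|) / N0%:R.
  by move=> ->; rewrite measure0 /= -addrA addr_ge0// mulr_ge0 ?face_weight_ge0// ltW.
have [lj0|lj0] := boolP (nat_of_ord (l j) == 0%N); last first.
  apply: PA0; apply/seteqP; split => // w /AP[_ [_ _ _ _ /eqP]].
  by rewrite (negbTE lj0).
rewrite face_weightE lj0 mul1r.
have sj_near w : A w -> `|(s j w)%:R - (N w)%:R * p j| <= Cb.
  move=> /AP[_ [v01 _ /(_ j) E _ _]].
  by move: E; rewrite /seat_excess => ->; exact: excess_bound.
pose L := (Num.truncn (N0%:R * p j + Cb)).+1.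
have LR : L%:R <= N0%:R * p j + Cb + 1.
  by rewrite -natr1 lerD2r truncn_le// addr_ge0// mulr_ge0// ltW.
pose E (n : 'I_L) := A `&` (s j @^-1` [set nat_of_ord n]).
have mE n : measurable (E n).
  by apply: measurableI => //; rewrite -[_ @^-1` _]setTI; exact: measurable_funP.
have A_E : fine (P A) <= \sum_(n < L) fine (P (E n)).
  apply: cover_le => // w Aw.
  have sL : (s j w < L)%N.
    rewrite /L ltnS truncn_ge_nat; last by rewrite addr_ge0// mulr_ge0// ltW.
    have := sj_near w Aw; rewrite ler_distl => /andP[_ /le_trans]; apply.
    rewrite lerD2r ler_pM2r// ler_nat.
    by case/AP: Aw => /andP[].
  by exists (Ordinal sL).
have E_g (n : 'I_L) : fine (P (E n)) <= g n / N0%:R.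
  have [->|/set0P[w0 [Aw0 sw0]]] := eqVneq (E n) set0.
    by rewrite measure0 divr_ge0.
  have [/andP[n1N NN0] [v01 vj Ev vl lj]] := AP _ Aw0.
  have n0s w : A w -> (n0 <= s j w)%N.
    move=> Aw; have [/andP[n1Nw _] _] := AP _ Aw.
    have := sj_near w Aw; rewrite ler_distl => /andP[H _].
    rewrite -(ler_nat R); apply: le_trans H; rewrite lerBrDr -ler_pdivrMr//.
    by apply: ltW; apply: lt_le_trans (truncnS_gt _) _; rewrite ler_nat.
  have EN : E n `<=` N @^-1` [set N w0].
    move=> w [Aw sw]; have [_ [v01' _ Ev' _ _]] := AP _ Aw.
    have ss : (fun i => s i w) =1 (fun i => s i w0).
      apply: (@gaps_inj R m p beta _ _ j) => //=; first by rewrite sw sw0.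
      by move=> i ij; apply: notie => //; exact: n0s.
    apply/eqP; rewrite -(eqr_nat R); apply/eqP.
    have : seat_excess p (N w) (fun i => s i w) j = seat_excess p (N w0) (fun i => s i w0) j.
      rewrite Ev' Ev; congr (excess_of_gaps p beta _ j).
      by apply/funext => i; rewrite /gaps !ss.
    by rewrite /seat_excess ss => /addrI/oppr_inj/(mulIf (lt0r_neq0 pj0)).
  have : fine (P (E n)) <= N0%:R^-1.
    have := Nunif (N w0); rewrite NN0 andbT (leq_trans _ n1N)// => /(_ isT) PN.
    rewrite -lee_fin -PN fineK ?fin_num_measure//; apply: le_measure => //; rewrite ?inE//.
    by rewrite -[_ @^-1` _]setTI; exact: measurable_funP.
  move/le_trans; apply; rewrite -[leLHS]mul1r ler_pM2r ?invr_gt0//.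
  apply: (g1 n (fun k => gaps p beta (fun i => s i w0) j (lift j k))) => k; first exact: vl.
  (* Modulo 1 the gap is n times the ratio [al k] plus [ga k]; the integer part is 1 - s_k. *)
  exists (1 - (s (lift j k) w0)%:Z); rewrite intrB -pmulrn /gaps /ga /al /= sw0 /=.
  by ring.
apply: (le_trans A_E); apply: (le_trans (ler_sum _ (fun n _ => E_g n))).
rewrite -mulr_suml ler_pdivrMr//; apply: (le_trans (gL L)); rewrite card_ord.
set Km := K%:R ^- m.-1.
have Km0 : 0 <= Km by rewrite invr_ge0 exprn_ge0.
have Km1 : Km <= 1 by rewrite invf_le1 ?exprn_gt0 ?ltr0n// exprn_ege1// ler1n.
rewrite [_ * N0%:R]mulrDl divfK ?gt_eqF// [_ * N0%:R]mulrDl.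
have := ler_norm Cg; move: LR; set Lr := L%:R => LR CgN.
apply: (@le_trans _ _ ((N0%:R * p j + Cb + 1) * (Km + e) + `|Cg|)).
  by rewrite lerD// ler_wpM2r// addr_ge0// ltW.
have : N0%:R * p j * e <= e * N0%:R by rewrite mulrC ler_wpM2l ?ler_piMr// ltW.
have : (Cb + 1) * (Km + e) <= (Cb + 1) * (1 + e) by rewrite ler_wpM2l ?addr_ge0// lerD2r.
lra.
Qed.
End HouseSide.

(** The expectation of [f] of the excesses, with the gaps moved to the lower corners of their cells,
    under the mixture with weights [q]. *)
Definition riemann_sum {R : realType} {m : nat} (p : 'I_m -> R) (beta : R)
    (f : 'rV[R]_m -> R) (q : 'I_m -> R) (K : nat) : R :=
  \sum_(l : {ffun 'I_m -> 'I_K})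
    f (\row_i excess_of_gaps p beta (corner l) i) * cell_weight q l.

Section Riemann.
Context {R : realType} {m : nat} (p : 'I_m -> R) (beta : R).
Hypothesis p_gt0 : forall i, 0 < p i.
Hypothesis p_sum : \sum_i p i = 1.

Lemma excess_lipschitz (v u : 'I_m -> R) (h : R) i :
  (forall i, `|v i - u i| <= h) ->
  `|excess_of_gaps p beta v i - excess_of_gaps p beta u i| <= (m%:R + 1) * h.
Proof.
move=> vu; rewrite /excess_of_gaps.
have pi1 : p i <= 1.
  by rewrite -p_sum (bigD1 i)//= lerDl sumr_ge0// => k _; exact: ltW.
have -> : p i * \sum_j v j - v i + (beta - 1) * (m%:R * p i - 1) -
   (p i * \sum_j u j - u i + (beta - 1) * (m%:R * p i - 1)) =
   p i * (\sum_j (v j - u j)) - (v i - u i) by rewrite sumrB; ring.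
apply: (le_trans (ler_normB _ _)); rewrite mulrDl mul1r lerD//.
rewrite normrM gtr0_norm//; apply: (@le_trans _ _ (`|\sum_j (v j - u j)|)).
  by rewrite ler_piMl.
apply: (le_trans (ler_norm_sum _ _ _)); apply: (le_trans (ler_sum _ (fun j _ => vu j))).
by rewrite sumr_const card_ord mulr_natl.
Qed.

Lemma excess_unif (f : 'rV[R]_m -> R) (e : R) : continuous f -> 0 < e ->
  exists K0 : nat, forall K (l : 'I_m -> 'I_K) (v : 'I_m -> R), (K0 <= K)%N ->
    (forall i, 0 <= v i <= 1) ->
    (forall i, (l i)%:R / K%:R <= v i <= (l i).+1%:R / K%:R) ->
    `|f (\row_i excess_of_gaps p beta v i) -
      f (\row_i excess_of_gaps p beta (corner l) i)| <= e.
Proof.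
move=> fc e0.
have [dl dl0 fdl] := @continuous_row_unif R m f (m%:R + 1 + `|beta - 1| * (m%:R + 1)) e fc e0.
exists (Num.truncn ((m%:R + 1) / dl)).+1 => K l v KK v01 vl.
apply: fdl => i; first exact: excess_bound.
have m1 : 0 < m%:R + 1 :> R by rewrite ltr_wpDl.
have K0 : 0 < K%:R :> R by rewrite ltr0n; apply: leq_trans KK.
apply: (@le_lt_trans _ _ ((m%:R + 1) * K%:R^-1)).
  apply: excess_lipschitz => k; have /andP[v1 v2] := vl k.
  rewrite /corner ger0_norm ?subr_ge0// lerBlDl (le_trans v2)//.
  by rewrite -natr1 mulrDl mul1r.
rewrite ltr_pdivrMr// mulrC -ltr_pdivrMr//.
by apply: lt_le_trans (truncnS_gt _) _; rewrite ler_nat.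
Qed.
End Riemann.

(** * Expectations on the house side *)

Section HouseRiemann.
Context {R : realType} {m : nat} (p : 'I_m -> R) (beta : R).
Hypothesis p_gt0 : forall i, 0 < p i.
Hypothesis p_sum : \sum_i p i = 1.
Hypothesis p_indep : rat_independent p.

(** Since |x| = 2 max(x, 0) - x, one-sided bounds and the total masses control the distance; this is
    how upper bounds on cell probabilities suffice. *)
Lemma sum_dist_one_sided (I : finType) (a b : I -> R) (u : R) : 0 <= u ->
  (forall i, a i - b i <= u) ->
  \sum_i `|a i - b i| <= 2 * #|I|%:R * u - (\sum_i a i - \sum_i b i).
Proof.
move=> u0 ab; rewrite -sumrB.
have -> : 2 * #|I|%:R * u = \sum_(i : I) 2 * u by rewrite sumr_const -[_ *+ #|I|]mulr_natl; ring.
rewrite -sumrB; apply: ler_sum => i _; have := ab i.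
by have [] := ger0P (a i - b i); lra.
Qed.

Lemma house_riemann (f : 'rV[R]_m -> R) (B e : R) :
  continuous f -> (forall x, `|f x| <= B) -> 0 < e ->
  exists K0 : nat, forall K, (K0 <= K)%N -> (0 < K)%N -> exists C : R,
  forall (N0 : nat) d (T : measurableType d) (P : probability T R)
    (N : {RV P >-> nat}) (s : 'I_m -> {RV P >-> nat}),
  (0 < N0)%N -> uniform_upto P N0 N ->
  (forall w, divisor_defined m beta (N w) ->
     divisor_allocation p beta (N w) (fun i => s i w)) ->
  let X w := f (\row_i seat_excess p (N w) (fun j => s j w) i) in
  ('E_P[X] = (fine 'E_P[X])%:E)%E /\
  `|fine 'E_P[X]%E - riemann_sum p beta f p K| <= e + C / N0%:R.
Proof.
move=> fc fB e0.
have B0 : 0 <= B by apply: le_trans (fB 0).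
have e20 : 0 < e / 2 by lra.
have [K0 K0P] := @excess_unif R m p beta p_gt0 p_sum f (e / 2) fc e20.
exists K0 => K KK0 Kgt0.
pose cells := {ffun 'I_m -> 'I_K}.
pose M : R := #|cells|%:R.
pose Mm : R := m%:R.
have M0 : 0 <= M by [].
have Mm0 : 0 <= Mm by [].
(* It is small enough for 2 M B m e1 <= e/2, the total of the Weyl errors over all cells and
   parties. *)
pose e1 := e / (4 * M * B * Mm + 2).
have den0 : 0 < 4 * M * B * Mm + 2 by rewrite ltr_wpDl// !mulr_ge0.
have e10 : 0 < e1 by rewrite divr_gt0.
have /choice[nC nCP] : forall jl : 'I_m * cells, exists nC : nat * R,
  forall (N0 : nat) d (T : measurableType d) (P : probability T R)
    (N : {RV P >-> nat}) (s : 'I_m -> {RV P >-> nat}) (A : set T),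
  (0 < N0)%N -> uniform_upto P N0 N -> measurable A ->
  (forall w, A w -> (nC.1 <= N w <= N0)%N /\
     in_cell p beta (N w) (fun i => s i w) jl.1 jl.2) ->
  fine (P A) <= p jl.1 * face_weight jl.1 jl.2 + e1 + nC.2 / N0%:R.
  move=> [j l].
  have [n [C nC]] :=
    @jump_cell_bound R m p beta p_gt0 p_sum p_indep K j l e1 Kgt0 e10.
  by exists (n, C).
have [na naP] := @allocation_gaps R m p beta p_gt0 p_sum.
pose nd := `|(m%:Z * (Num.floor `|beta| + 1))%R|%N.
(* From this size on the method is defined, the gaps describe the allocation and all the bounds of
   [jump_cell_bound] apply. *)
pose nn := (na + nd + (\max_jl (nC jl).1))%N.
pose CC : R := \sum_jl `|(nC jl).2|.
have CC0 : 0 <= CC by apply: sumr_ge0.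
have CCP jl : (nC jl).2 <= CC.
  by rewrite (le_trans (ler_norm _))// /CC (bigD1 jl)//= lerDl sumr_ge0.
exists (B * nn%:R + B * (2 * M * (Mm * CC) + nn%:R)) => N0 d T P N s N00 Nunif alloc X.
have N0R : 0 < N0%:R :> R by rewrite ltr0n.
have i0 : 'I_m.
  case: m p p_sum => [q|n _ _]; last exact: ord0.
  by rewrite big_ord0 => /esym/eqP; rewrite oner_eq0.
(* Party and cell are chosen as functions of (N, s), which takes countably many values, so every
   event defined from them is measurable whatever the choice; outside the relevant cases a default
   value is taken. *)
have /choice[sel selP] : forall Ns : nat * {ffun 'I_m -> nat}, exists jl : 'I_m * cells,
    (nn <= Ns.1)%N -> divisor_allocation p beta Ns.1 Ns.2 ->
    in_cell p beta Ns.1 Ns.2 jl.1 jl.2.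
  move=> [n c] /=.
  have [[nnn al]|no] := pselect ((nn <= n)%N /\ divisor_allocation p beta n c); last first.
    by exists (i0, [ffun=> Ordinal Kgt0]) => nnn al; case: no.
  have [|j [v01 vj vE]] := naP n c _ al; first by rewrite (leq_trans _ nnn)// /nn -addnA leq_addr.
  have /choice[l lP] : forall i, exists a : 'I_K,
    a%:R / K%:R <= gaps p beta c j i <= a.+1%:R / K%:R /\
    (gaps p beta c j i = 0 -> a = 0%N :> nat).
    by move=> i; exact: unit_interval_cell.
  exists (j, [ffun i => l i]) => _ _ /=; split => //.
  - by move=> i; rewrite ffunE; case: (lP i).
  - by rewrite ffunE; case: (lP j) => _; apply.
have sE w : (fun i => s i w) = [ffun i => s i w] by apply/funext => i; rewrite ffunE.
pose Z w : nat * {ffun 'I_m -> nat} := (N w, [ffun i => s i w]).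
have mN n : measurable (N @^-1` [set n]).
  by rewrite -[_ @^-1` _]setTI; exact: measurable_funP.
have ms i n : measurable (s i @^-1` [set n]).
  by rewrite -[_ @^-1` _]setTI; exact: measurable_funP.
have mZ (S : set (nat * {ffun 'I_m -> nat})) : measurable (Z @^-1` S).
  apply: countable_preimage_measurable => -[n c].
  rewrite (_ : _ @^-1` _ = (N @^-1` [set n]) `&` ((fun w => [ffun i => s i w]) @^-1` [set c])).
    by apply: measurableI => //; exact: ffun_preimage_measurable.
  by apply/seteqP; split => w; rewrite /Z /= => -[-> ->].
pose G := [set w | (nn <= N w <= N0)%N].
have defd n : (nn <= n)%N -> divisor_defined m beta n.
  move=> nnn _; apply: (@le_trans _ _ nd%:Z); first by rewrite /nd abszE ler_norm.
  by rewrite lez_nat (leq_trans _ nnn)// /nn -addnA addnCA leq_addr.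
have cellG w : G w -> in_cell p beta (N w) (fun i => s i w) (sel (Z w)).1 (sel (Z w)).2.
  move=> /andP[nnn _].
  by rewrite sE; apply: (selP (Z w)) => //=; rewrite -sE; exact/alloc/defd.
pose Al (l : cells) := [set w | G w /\ (sel (Z w)).2 = l].
pose Ajl (l : cells) j := [set w | Al l w /\ (sel (Z w)).1 = j].
have mAl l : measurable (Al l).
  exact: (mZ [set Ns | (nn <= Ns.1 <= N0)%N /\ (sel Ns).2 = l]).
have mAjl l j : measurable (Ajl l j).
  exact: (mZ [set Ns | ((nn <= Ns.1 <= N0)%N /\ (sel Ns).2 = l) /\ (sel Ns).1 = j]).
have mX : measurable_fun setT X.
  move=> _ Y mY; rewrite setTI.
  have := mZ [set Ns : nat * {ffun 'I_m -> nat} | Y (f (\row_i seat_excess p Ns.1 Ns.2 i))].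
  by congr measurable; apply/seteqP; split => w; rewrite /Z /X /= -sE.
have Al_le l : fine (P (Al l)) <= cell_weight p l + Mm * (e1 + CC / N0%:R).
  apply: (@le_trans _ _ (\sum_j fine (P (Ajl l j)))).
    by apply: cover_le => // w Aw; exists (sel (Z w)).1.
  have -> : Mm * (e1 + CC / N0%:R) = \sum_(j < m) (e1 + CC / N0%:R).
    by rewrite sumr_const card_ord mulr_natl.
  rewrite /cell_weight -big_split /=; apply: ler_sum => j _; rewrite addrA.
  apply: le_trans (nCP (j, l) N0 d T P N s (Ajl l j) N00 Nunif (mAjl l j) _) _.
    move=> w [[Gw sl] sj] /=; rewrite -sl -sj; split; last exact: cellG.
    move: Gw => /andP[nnn ->]; rewrite andbT (leq_trans _ nnn)//.
    by rewrite (leq_trans _ (leq_addl _ _))//; exact: (leq_bigmax (_, _)).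
  by rewrite /= lerD2l ler_pM2r ?invr_gt0.
(* Only the houses below the threshold are lost, and they have mass at most nn/N0. *)
have sum_Al : 1 - nn%:R / N0%:R <= \sum_l fine (P (Al l)).
  have G_Al : fine (P G) <= \sum_l fine (P (Al l)).
    apply: cover_le => //; first exact: (mZ [set Ns | (nn <= Ns.1 <= N0)%N]).
    by move=> w Gw; exists (sel (Z w)).2.
  apply: le_trans G_Al.
  have mG : measurable G by exact: (mZ [set Ns | (nn <= Ns.1 <= N0)%N]).
  have PNk (k : 'I_N0) : fine (P (N @^-1` [set k.+1])) = N0%:R^-1.
    by rewrite Nunif//= ltn_ord.
  have N1 : \sum_(k < N0) fine (P (N @^-1` [set k.+1])) = 1.
    rewrite (eq_bigr (fun=> N0%:R^-1)) => [|k _]; last exact: PNk.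
    by rewrite sumr_const card_ord -[_ *+ N0]mulr_natl divff// gt_eqF.
  rewrite lerBlDr addrC; apply: (@le_trans _ _ (\sum_(k < N0) fine (P (N @^-1` [set k.+1])))).
    by rewrite N1.
  rewrite (bigID (fun k : 'I_N0 => (k < nn)%N)) /= lerD//.
    rewrite (eq_bigr (fun=> N0%:R^-1)) => [|k _]; last exact: PNk.
    rewrite sumr_const -[_ *+ #|_|]mulr_natl ler_pM2r ?invr_gt0// ler_nat.
    exact: card_ord_lt.
  apply: disjoint_le => //.
    by move=> k k' w /= -> [] /val_inj.
  move=> k; rewrite -leqNgt => nnk w /= Nw; rewrite /G /= Nw.
  by rewrite ltn_ord (leq_trans nnk).
have [|||EX dist] := @expectation_step_dist R d T P X B (e / 2) cells Al
   (fun l => f (\row_i excess_of_gaps p beta (corner l) i)) mX (fun w => fB _) mAl.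
- by move=> l l' w [_ <-] [_ <-].
- move=> l w [Gw sl]; have [v01 _ vE vl _] := cellG w Gw.
  rewrite /X (_ : \row_i _ = \row_i excess_of_gaps p beta
    (gaps p beta (fun i => s i w) (sel (Z w)).1) i).
    by rewrite -sl; exact: K0P.
  by apply/rowP => i; rewrite !mxE.
- exact: ltW.
split => //.
set b := fun l => fine (P (Al l)) in dist sum_Al.
have sumw : \sum_(l : cells) cell_weight p l = 1 by apply: sum_cell_weight.
pose u := Mm * (e1 + CC / N0%:R).
have u0 : 0 <= u by rewrite mulr_ge0// addr_ge0 ?(ltW e10)// divr_ge0.
have bw : \sum_l `|b l - cell_weight p l| <= 2 * M * u + nn%:R / N0%:R.
  apply: (le_trans (@sum_dist_one_sided cells b (fun l => cell_weight p l) u u0 _)).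
    by move=> l; rewrite lerBlDl; exact: Al_le.
  by rewrite sumw lerD2l; lra.
have step2 : `|\sum_(l : cells) f (\row_i excess_of_gaps p beta (corner l) i) * b l
    - riemann_sum p beta f p K| <= B * (2 * M * u + nn%:R / N0%:R).
  rewrite /riemann_sum -sumrB; apply: (le_trans (ler_norm_sum _ _ _)).
  apply: le_trans (ler_wpM2l B0 bw); rewrite mulr_sumr; apply: ler_sum => l _.
  by rewrite -mulrBr normrM ler_wpM2r.
apply: (le_trans (ler_distD _ _ _)); apply: (le_trans (lerD dist step2)).
have : B * (1 - \sum_l b l) <= B * (nn%:R / N0%:R) by rewrite ler_wpM2l//; lra.
have : 2 * M * B * Mm * e1 <= e / 2.
  rewrite /e1 mulrA ler_pdivrMr//; nra.
rewrite /u; set y := N0%:R^-1; lra.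
Qed.
End HouseRiemann.

(** * The limit variables *)

(** Half-open cells, so that distinct ones are disjoint; on the house side [sel] picks one closed
    cell instead. *)
Definition cell_event {R : realType} {m K : nat} {T : Type} (V : 'I_m -> T -> R)
    (l : 'I_m -> 'I_K) : set T :=
  [set w | forall i, (l i)%:R / K%:R <= V i w < (l i).+1%:R / K%:R].

Section LimitSide.
Context {R : realType}.

Lemma cell_subset K (a : 'I_K) (x : R) :
  a%:R / K%:R <= x < a.+1%:R / K%:R -> 0 <= x <= 1.
Proof.
move=> /andP[x1 x2]; have K0 : 0 < K%:R :> R by rewrite ltr0n (leq_ltn_trans _ (ltn_ord a)).
rewrite (le_trans _ x1) ?divr_ge0//=; apply/ltW/(lt_le_trans x2).
by rewrite ler_pdivrMr// mul1r ler_nat.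
Qed.

Lemma cell_disjoint K (a b : 'I_K) (x : R) :
  a%:R / K%:R <= x < a.+1%:R / K%:R -> b%:R / K%:R <= x < b.+1%:R / K%:R -> a = b.
Proof.
have iK0 : 0 < K%:R^-1 :> R by rewrite invr_gt0 ltr0n (leq_ltn_trans _ (ltn_ord a)).
move=> /andP[a1 a2] /andP[b1 b2]; apply/val_inj/eqP; rewrite eqn_leq.
have ab : (a < b.+1)%N by have := le_lt_trans a1 b2; rewrite ltr_pM2r// ltr_nat.
have ba : (b < a.+1)%N by have := le_lt_trans b1 a2; rewrite ltr_pM2r// ltr_nat.
by rewrite -ltnS ab -ltnS ba.
Qed.

Lemma measurable_cell_event {m : nat} d (T : measurableType d)
    (V : 'I_m -> T -> R) K (l : 'I_m -> 'I_K) :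
  (forall i, measurable_fun setT (V i)) -> measurable (cell_event V l).
Proof.
move=> mV; rewrite (_ : cell_event V l = \bigcap_(i in [set: 'I_m])
    (setT `&` V i @^-1` `[(l i)%:R / K%:R, (l i).+1%:R / K%:R[%classic)).
  by apply: fin_bigcap_measurable => // i _; apply: mV.
apply/seteqP; split => w Vw i; first by move=> _; split => //=; rewrite in_itv; exact: Vw.
by have [_ /=] := Vw i Logic.I; rewrite in_itv.
Qed.

(** Only the cell probabilities of [V] matter; they sum to 1, so no mass lies outside the cells. *)
Lemma limit_riemann {m : nat} (p : 'I_m -> R) (beta : R) (q : 'I_m -> R)
    d (T : measurableType d) (Q : probability T R) (V : 'I_m -> T -> R)
    (f : 'rV[R]_m -> R) (B e : R) :
  (forall i, 0 < p i) -> \sum_i p i = 1 -> \sum_i q i = 1 ->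
  (forall i, measurable_fun setT (V i)) ->
  (forall K (l : 'I_m -> 'I_K), (0 < K)%N ->
     fine (Q (cell_event V l)) = cell_weight q l) ->
  continuous f -> (forall x, `|f x| <= B) -> 0 < e ->
  exists K0 : nat, forall K, (K0 <= K)%N -> (0 < K)%N ->
  let X w := f (\row_i excess_of_gaps p beta (fun j => V j w) i) in
  ('E_Q[X] = (fine 'E_Q[X])%:E)%E /\
  `|fine 'E_Q[X]%E - riemann_sum p beta f q K| <= e.
Proof.
move=> p_gt0 p_sum q_sum mV QV fc fB e0.
have [K0 K0P] := @excess_unif R m p beta p_gt0 p_sum f e fc e0.
exists K0 => K KK Kgt0 X.
have mX : measurable_fun setT X.
  apply: continuous_row_measurable => // i; rewrite /excess_of_gaps.
  apply: measurable_funD; last exact: measurable_cst.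
  apply: measurable_funB; last exact: mV.
  by apply: measurable_funM; [exact: measurable_cst|apply: measurable_sum].
have mA (l : {ffun 'I_m -> 'I_K}) : measurable (cell_event V l).
  exact: measurable_cell_event.
have [|||EX dist] := @expectation_step_dist R d T Q X B e {ffun 'I_m -> 'I_K}
   (fun l => cell_event V l) (fun l => f (\row_i excess_of_gaps p beta (corner l) i))
   mX (fun w => fB _) mA.
- by move=> l l' w lw lw'; apply/ffunP => i; exact: cell_disjoint (lw i) (lw' i).
- move=> l w lw; apply: K0P => // i; first exact: cell_subset (lw i).
  by have /andP[-> /ltW ->] := lw i.
- exact: ltW.
split => //; move: dist; rewrite (eq_bigr (fun l : {ffun 'I_m -> 'I_K} =>
    f (\row_i excess_of_gaps p beta (corner l) i) * cell_weight q l)) => [|l _]; last by rewrite QV.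
rewrite -/(riemann_sum p beta f q K) (eq_bigr (fun l : {ffun 'I_m -> 'I_K} =>
    cell_weight q l)) => [|l _]; last by rewrite QV.
by rewrite sum_cell_weight// subrr mulr0 addr0.
Qed.

(** All endpoint conventions are covered, since a half-open cell that is reflected, as in
    [marginal_cell_event], becomes open on the left. *)
Lemma uniform_prob_itv (a b x y : R) (ab : a < b) (b0 b1 : bool) :
  a <= x -> x <= y -> y <= b ->
  uniform_prob ab [set` Interval (BSide b0 x) (BSide b1 y)] = ((y - x) / (b - a))%:E.
Proof.
move=> ax xy yb; rewrite /uniform_prob.
have -> : (\int[lebesgue_measure]_(z in [set` Interval (BSide b0 x) (BSide b1 y)])
    (uniform_pdf a b z)%:E =
  \int[lebesgue_measure]_(z in [set` Interval (BSide b0 x) (BSide b1 y)])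
    (cst (b - a)^-1%:E) z)%E.
  apply: eq_integral => z /set_mem /= zI; rewrite /uniform_pdf.
  move: zI; rewrite in_itv => /andP[z1 z2].
  have -> : a <= z <= b.
    by rewrite (le_trans ax (lteifW z1)) (le_trans (lteifW z2) yb).
  by [].
rewrite integral_cst//= lebesgue_measure_itv /= lte_fin.
have [xy'|] := ltP x y; first by rewrite -EFinD -EFinM mulrC.
rewrite le_eqVlt ltNge xy orbF => /eqP ->.
by rewrite subrr mul0r mule0.
Qed.

Lemma independent_prod d (T : measurableType d) (P : probability T R)
    (I : finType) (F : I -> set_system T) (A : I -> set T) :
  independent_systems P F -> (forall i, F i (A i)) ->
  P [set w | forall i, A i w] = (\prod_i P (A i))%E.
Proof.
move=> ind FA; have := ind [set: I]%SET A (fun i _ => FA i).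
rewrite (eq_bigl xpredT) => [<-|i]; last by rewrite inE.
congr (P _); apply/seteqP; split => [w Aw i _|w Aw i]; first exact: Aw.
by apply: Aw; rewrite /= inE.
Qed.

Lemma fine_prod (I : finType) (F : I -> \bar R) :
  (forall i, F i \is a fin_num) -> fine (\prod_i F i)%E = \prod_i fine (F i).
Proof.
move=> Ffin; rewrite (eq_bigr (fun i => (fine (F i))%:E)) => [|i _]; last by rewrite fineK.
by rewrite prodEFin.
Qed.

Lemma uniform_on_itv d (T : measurableType d) (P : probability T R)
    (a b x y : R) (ab : a < b) (X : {RV P >-> R}) (b0 b1 : bool) :
  uniform_on ab X -> a <= x -> x <= y -> y <= b ->
  P (X @^-1` [set` Interval (BSide b0 x) (BSide b1 y)]) = ((y - x) / (b - a))%:E.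
Proof.
move=> unif ax xy yb; rewrite -(@uniform_prob_itv a b x y ab b0 b1 ax xy yb) -unif//.
Qed.

Lemma events_of_preimage d (T : measurableType d) d' (S : measurableType d')
  (X : T -> S) (B : set S) : measurable B -> events_of X (X @^-1` B).
Proof. by move=> mB; exists B => //; rewrite setTI. Qed.
End LimitSide.

(** * The joint limit law *)

Section Joint.
Context {R : realType} {m : nat} (p : 'I_m -> R).
Context {d : measure_display} {T : measurableType d} (Q : probability T R).

Lemma measure_split (I : finType) (A : set T) (B : I -> set T) :
  measurable A -> (forall i, measurable (B i)) ->
  (forall i i' w, B i w -> B i' w -> i = i') ->
  (forall w, exists i, B i w) ->
  fine (Q A) = \sum_i fine (Q (A `&` B i)).
Proof.
move=> mA mB triv cov.
have mAB i : measurable (A `&` B i) by exact: measurableI.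
apply/eqP; rewrite eq_le; apply/andP; split.
  by apply: cover_le => // w Aw; have [i Bi] := cov w; exists i.
apply: disjoint_le => // i i' w [_ Bi] [_ Bi'].
exact: triv Bi Bi'.
Qed.

Lemma big_option_prod (I : finType) (F : option I -> R) :
  \prod_o F o = F None * \prod_i F (Some i).
Proof.
rewrite (bigD1 None)//=; congr (_ * _).
rewrite (reindex_omap Some id); last by case.
by apply: eq_bigl => i; rewrite eqxx.
Qed.

(** On J = j the entry V_j is 0, so the cell must touch that face; the other entries are uniform and
    independent of J. *)
Lemma joint_cell_event (U : 'I_m -> {RV Q >-> R}) (J : T -> 'I_m) :
  (forall j, uniform_on ltr01 (U j)) ->
  (forall j, measurable (J @^-1` [set j])) ->
  (forall j, Q (J @^-1` [set j]) = (p j)%:E) ->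
  independent_systems Q
    (fun o : option 'I_m =>
       if o is Some j then events_of (U j) else events_of_fin J) ->
  (forall i, measurable_fun setT (zeroed_at (fun j => U j : T -> R) J i)) /\
  forall K (l : 'I_m -> 'I_K), (0 < K)%N ->
  fine (Q (cell_event (zeroed_at (fun j => U j : T -> R) J) l)) = cell_weight p l.
Proof.
move=> Uu mJ QJ ind.
have mV i : measurable_fun setT (zeroed_at (fun j => U j : T -> R) J i).
  apply: measurable_fun_if => //.
  - move=> _ Y mY; rewrite setTI.
    have := countable_preimage_measurable _ J mJ [set j | Y (i == j)].
    by congr measurable; apply/seteqP; split.
  - exact: measurable_funTS.
split => // K l K0.
rewrite (@measure_split _ _ (fun j => J @^-1` [set j])) => //; first last.
- by move=> w; exists (J w).
- by move=> j j' w /= -> ->.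
- exact: measurable_cell_event.
rewrite /cell_weight; apply: eq_bigr => j _.
have KR : 0 < K%:R :> R by rewrite ltr0n.
have [lj0|lj0] := boolP (nat_of_ord (l j) == 0%N); last first.
  rewrite face_weightE (negbTE lj0) mul0r mulr0 (_ : _ `&` _ = set0) ?measure0//.
  apply/seteqP; split => // w [/(_ j) + Jw]; rewrite /zeroed_at Jw eqxx => /andP[+ _].
  by rewrite ler_pdivrMr// mul0r lern0 (negbTE lj0).
(* On J = j the variable U_j is left unconstrained. *)
pose B i : set R := if i == j then setT else `[(l i)%:R / K%:R, (l i).+1%:R / K%:R[%classic.
pose A (o : option 'I_m) := if o is Some i then U i @^-1` (B i) else J @^-1` [set j].
have mB i : measurable (B i) by rewrite /B; case: ifP.
have -> : cell_event (zeroed_at (fun j => U j : T -> R) J) l `&` J @^-1` [set j] =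
    [set w | forall o, A o w].
  apply/seteqP; split => w.
    move=> [wV Jw] [i|] //=; rewrite /B; case: eqP => // /eqP ij.
    by have := wV i; rewrite /zeroed_at Jw (negbTE ij) /= in_itv.
  move=> wA; have Jw := wA None; split => // i; rewrite /zeroed_at Jw.
  have := wA (Some i); rewrite /A /= /B; case: eqP => [->|_] /=; last by rewrite in_itv.
  by rewrite (eqP lj0) mul0r lexx divr_gt0.
rewrite (independent_prod _ _ _ _ _ _ ind); last first.
  move=> [i|] /=; first exact: events_of_preimage.
  by exists [set j] => //; rewrite setTI.
have mA o : measurable (A o).
  by case: o => [i|] //=; rewrite -[_ @^-1` _]setTI; exact: measurable_funP.
rewrite fine_prod => [|o]; last exact: fin_num_measure.
rewrite big_option_prod /= QJ /=; congr (_ * _); apply: eq_bigr => i _.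
rewrite /B; case: eqP => [->|_]; first by rewrite preimage_setT probability_setT lj0.
rewrite (@uniform_on_itv R d T Q 0 1 ((l i)%:R / K%:R) ((l i).+1%:R / K%:R)
  ltr01 (U i) true true (Uu i)).
- by rewrite /= subr0 divr1 -mulrBl -natr1 addrC addKr mul1r.
- by rewrite divr_ge0.
- by rewrite ler_pM2r ?invr_gt0// ler_nat.
- by rewrite ler_pdivrMr// mul1r ler_nat.
Qed.
End Joint.

(** * The marginal limit law *)

Section Marginal.
Context {R : realType} {n : nat} (p : 'I_n.+2 -> R) (i : 'I_n.+2).
Context {d : measure_display} {T : measurableType d}.

Definition shifted (u : T -> R) (w : T) : R := u w + p i - 2^-1.

(* Inverts [limit_marginal]: the sign of [shifted], which is uniform on (p_i - 1, p_i),
   decides whether V_i or V_k, with k = [lift i ord0], is the gap equal to 0; the choice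
   of k among the other parties does not affect the excess of party i. *)
Definition split_gaps (Ut : nat -> T -> R) (j : 'I_n.+2) (w : T) : R :=
  let W := shifted (Ut 0%N) w in
  if unlift i j is Some k then
    if k == ord0 then (if 0 <= W then W / p i else 0) else Ut k w + 2^-1
  else (if 0 <= W then 0 else - W / (1 - p i)).

(** The law of the index of the vanishing gap in [split_gaps]: the shifted variable is nonnegative
    with probability p_i. *)
Definition split_weight (j : 'I_n.+2) : R :=
  if j == i then p i else if j == lift i ord0 then 1 - p i else 0.

Lemma sum_split_weight (F : 'I_n.+2 -> R) :
  \sum_j split_weight j * F j = p i * F i + (1 - p i) * F (lift i ord0).
Proof.
rewrite (bigD1_ord i)//= {1}/split_weight eqxx big_ord_recl.
rewrite /split_weight eq_sym (negbTE (neq_lift _ _)) eqxx big1 ?addr0// => k _.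
by rewrite eq_sym (negbTE (neq_lift _ _)) (inj_eq lift_inj) mul0r.
Qed.

(** For either sign, p_i V_k - (1 - p_i) V_i = W with k = [lift i ord0]. The shift p_i - 1/2 and the
    n summands p_i/2 add up to (m p_i - 1)/2, which turns beta - 1 into beta - 1/2. *)
Lemma limit_marginalE (beta : R) (Ut : nat -> T -> R) (w : T) : p i != 0 -> 1 - p i != 0 ->
  limit_marginal p beta Ut i w = excess_of_gaps p beta (fun j => split_gaps Ut j w) i.
Proof.
move=> p0 p1; rewrite /limit_marginal /excess_of_gaps (bigD1_ord i)//= big_ord_recl.
rewrite (eq_bigr (fun k : 'I_n => Ut k.+1 w + 2^-1)) => [|k _]; last first.
  by rewrite /split_gaps liftK.
rewrite big_split /= sumr_const card_ord -[_ *+ n]mulr_natl.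
rewrite /split_gaps liftK unlift_none eqxx /shifted big_add1 big_mkord.
have -> : n.+2%:R = n%:R + 2 :> R by rewrite -addn2 natrD.
by case: ifP => _; field; rewrite ?p0 ?p1.
Qed.
End Marginal.

Section MarginalCells.
Context {R : realType} {n : nat} (p : 'I_n.+2 -> R) (i : 'I_n.+2).
Context {d : measure_display} {T : measurableType d} (Q : probability T R).
Hypothesis p_gt0 : forall i, 0 < p i.
Hypothesis p_sum : \sum_i p i = 1.

Lemma share_lt1 : p i < 1.
Proof.
rewrite -p_sum (bigD1_ord i)//= big_ord_recl ltrDl ltr_pwDl// sumr_ge0// => k _.
exact: ltW.
Qed.

(** For each sign of W the cell is a product of intervals for the independent variables [Ut k]; its
    factor for k = 0 has length p_i/K or (1 - p_i)/K. *)
Lemma marginal_cell_event (Ut : nat -> {RV Q >-> R}) :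
  (forall k, (k < n.+1)%N -> uniform_on ltNhalf (Ut k)) ->
  independent_systems Q (fun k : 'I_n.+1 => events_of (Ut k)) ->
  (forall j, measurable_fun setT (split_gaps p i (fun k => Ut k : T -> R) j)) /\
  forall K (l : 'I_n.+2 -> 'I_K), (0 < K)%N ->
  fine (Q (cell_event (split_gaps p i (fun k => Ut k : T -> R)) l)) =
  cell_weight (split_weight p i) l.
Proof.
move=> Uu ind; have pi1 := share_lt1; have pi0 := p_gt0 i.
set V := split_gaps p i _.
pose W := shifted p i (Ut 0%N).
have mW : measurable_fun setT W.
  apply: measurable_funB; last exact: measurable_cst.
  by apply: measurable_funD; [exact: measurable_funP|exact: measurable_cst].
have mW0 : measurable_fun setT (fun w => 0 <= W w).
  by apply: measurable_fun_ler => //; exact: measurable_cst.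
have mV j : measurable_fun setT (V j).
  rewrite /V /split_gaps; case: unlift => [k|].
    case: eqP => _; last first.
      by apply: measurable_funD; [exact: measurable_funP|exact: measurable_cst].
    apply: measurable_fun_ifT; [exact: mW0| |exact: measurable_cst].
    by apply: measurable_funM => //; exact: measurable_cst.
  apply: measurable_fun_ifT; [exact: mW0|exact: measurable_cst|].
  apply: measurable_funM; last exact: measurable_cst.
  exact: measurableT_comp.
split => // K l K0.
have KR : 0 < K%:R :> R by rewrite ltr0n.
pose S b := [set w | (0 <= W w) = b].
have mS b : measurable (S b).
  by have := mW0 measurableT [set b] Logic.I; rewrite setTI.
rewrite (@measure_split R d T Q _ _ S) => //; first last.
- by move=> w; exists (0 <= W w).
- by move=> b b' w /= <- <-.
- exact: measurable_cell_event.
rewrite /cell_weight sum_split_weight big_bool /=.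
pose lo j : R := (l j)%:R / K%:R.
pose hi j : R := (l j).+1%:R / K%:R.
have lohi j : hi j = lo j + K%:R^-1 by rewrite /hi -natr1 mulrDl mul1r.
have lo0 j : 0 <= lo j by rewrite divr_ge0.
have hi1 j : hi j <= 1 by rewrite ler_pdivrMr// mul1r ler_nat.
have iK : 0 < K%:R^-1 :> R by rewrite invr_gt0.
have half : (2^-1 : R) - - 2^-1 = 1 by lra.
pose cellk (k : 'I_n) : interval R :=
  `[lo (lift i (lift ord0 k)) - 2^-1, hi (lift i (lift ord0 k)) - 2^-1[.
have prodK (I : 'I_n.+1 -> interval R) (c : R) :
    Q (Ut 0%N @^-1` [set` I ord0]) = (c / K%:R)%:E ->
    (forall k : 'I_n, I (lift ord0 k) = cellk k) ->
    fine (Q [set w | forall k : 'I_n.+1, Ut k w \in I k]) = c * K%:R ^- n.+1.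
  move=> I0 Ik.
  rewrite (@independent_prod _ _ _ Q _ _ (fun k : 'I_n.+1 => Ut k @^-1` [set` I k]) ind);
    last by move=> k; exact: events_of_preimage.
  rewrite fine_prod => [|k]; last first.
    by apply: fin_num_measure; rewrite -[_ @^-1` _]setTI; exact: measurable_funP.
  rewrite big_ord_recl /= I0 /= (eq_bigr (fun=> K%:R^-1)) => [|k _].
    by rewrite prodr_const card_ord -mulrA -exprVn -exprS exprVn.
  rewrite Ik /cellk (@uniform_on_itv R d T Q _ _ _ _ ltNhalf (Ut _) true true (Uu _ _)).
  - by rewrite /= half divr1 lohi; ring.
  - exact: ltn_ord (lift ord0 k).
  - by have := lo0 (lift i (lift ord0 k)); lra.
  - by rewrite lohi; lra.
  - by have := hi1 (lift i (lift ord0 k)); lra.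
have VP w k : V (lift i (lift ord0 k)) w = Ut (lift ord0 k) w + 2^-1.
  by rewrite /V /split_gaps liftK.
have V0 w : V (lift i ord0) w = if 0 <= W w then W w / p i else 0.
  by rewrite /V /split_gaps liftK eqxx.
have Vi w : V i w = if 0 <= W w then 0 else - W w / (1 - p i).
  by rewrite /V /split_gaps unlift_none.
have cellE w : cell_event V l w <-> [/\ lo i <= V i w < hi i,
    lo (lift i ord0) <= V (lift i ord0) w < hi (lift i ord0) &
    forall k : 'I_n, Ut (lift ord0 k) w \in cellk k].
  split => [wl|[wi w0 wk] j].
    split => [||k]; [exact: wl|exact: wl|].
    by have := wl (lift i (lift ord0 k)); rewrite VP /cellk in_itv /= /lo /hi; lra.
  case: (unliftP i j) => [k|] ->; last exact: wi.
  case: (unliftP ord0 k) => [k'|] ->; last exact: w0.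
  by have := wk k'; rewrite VP /cellk in_itv /= /lo /hi; lra.
have allE (I : 'I_n.+1 -> interval R) w :
    (forall k : 'I_n, I (lift ord0 k) = cellk k) ->
    (forall k : 'I_n.+1, Ut k w \in I k) <-> Ut 0%N w \in I ord0 /\
    forall k : 'I_n, Ut (lift ord0 k) w \in cellk k.
  move=> Ik; split => [wI|[w0 wk] k].
    by split => [|k]; [exact: (wI ord0)|rewrite -Ik; exact: wI].
  by case: (unliftP ord0 k) => [k'|] -> //; rewrite Ik; exact: wk.
pose mkI (I0 : interval R) (k : 'I_n.+1) : interval R :=
  if k == ord0 then I0 else `[lo (lift i k) - 2^-1, hi (lift i k) - 2^-1[.
have faceE (A : set T) (j : 'I_n.+2) (c : R) (I0 : interval R) :
    (~~ (nat_of_ord (l j) == 0%N) -> A = set0) ->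
    Q (Ut 0%N @^-1` [set` I0]) = (c / K%:R)%:E ->
    (nat_of_ord (l j) == 0%N -> A = [set w | forall k : 'I_n.+1, Ut k w \in mkI I0 k]) ->
    fine (Q A) = c * face_weight j l.
  move=> A0 I0c AE; rewrite face_weightE.
  have [lj|lj] := boolP (nat_of_ord (l j) == 0%N); last by rewrite A0// measure0 mul0r mulr0.
  by rewrite AE// (@prodK (mkI I0) c) ?mul1r.
have UW w : Ut 0%N w = W w - p i + 2^-1 by rewrite /W /shifted; ring.
have p1 : 0 < 1 - p i by lra.
congr (_ + _).
- apply: (@faceE _ i (p i) `[2^-1 - p i + lo (lift i ord0) * p i,
    2^-1 - p i + hi (lift i ord0) * p i[).
  + move=> li; apply/seteqP; split => // w [/cellE[+ _ _] Sw]; rewrite Vi Sw => /andP[+ _].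
    by rewrite /lo ler_pdivrMr// mul0r lern0 (negbTE li).
  + rewrite (@uniform_on_itv R d T Q _ _ _ _ ltNhalf (Ut _) true true (Uu _ _)) ?lohi//.
    * by rewrite half divr1; congr EFin; ring.
    * by have := lo0 (lift i ord0); nra.
    * by nra.
    * by rewrite -lohi; have := hi1 (lift i ord0); nra.
  + move=> li; apply/seteqP; split => w.
      move=> [/cellE[_ + wk] Sw]; rewrite V0 Sw ler_pdivlMr// ltr_pdivrMr// => /andP[w1 w2].
      by apply/allE => //; split => //; rewrite /mkI /= in_itv /= UW; apply/andP; split; lra.
    move=> /allE[] // ; rewrite {1}/mkI /= in_itv /= UW => /andP[w1 w2] wk.
    have Sw : 0 <= W w.
      have : 0 <= lo (lift i ord0) * p i by rewrite mulr_ge0// ltW.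
      by lra.
    split => //; apply/cellE; rewrite Vi V0 Sw; split => //.
      by rewrite /lo /hi (eqP li) mul0r lexx divr_gt0.
    by rewrite ler_pdivlMr// ltr_pdivrMr//; apply/andP; split; lra.
(* Here W = -(1 - p_i) V_i reverses the cell. The right end is included unless l_i = 0, because W =
   0 belongs to the other case. *)
- apply: (@faceE _ (lift i ord0) (1 - p i) (Interval (BRight (2^-1 - p i - hi i * (1 - p i)))
     (BSide (nat_of_ord (l i) == 0%N) (2^-1 - p i - lo i * (1 - p i))))).
  + move=> li; apply/seteqP; split => // w [/cellE[_ + _] Sw]; rewrite V0 Sw => /andP[+ _].
    by rewrite /lo ler_pdivrMr// mul0r lern0 (negbTE li).
  + rewrite (@uniform_on_itv R d T Q _ _ _ _ ltNhalf (Ut _) false _ (Uu _ _)) ?lohi//.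
    * by rewrite half divr1; congr EFin; ring.
    * by rewrite -lohi; have := hi1 i; nra.
    * by nra.
    * by have := lo0 i; nra.
  + move=> li; apply/seteqP; split => w.
      move=> [/cellE[+ _ wk] Sw]; rewrite Vi Sw ler_pdivlMr// ltr_pdivrMr// => /andP[w1 w2].
      apply/allE => //; split => //; rewrite /mkI /= itv_boundlr /= !bnd_simp UW.
      have Wlt : W w < 0 by rewrite ltNge Sw.
      apply/andP; split; first lra.
      have [l0|_] := boolP (nat_of_ord (l i) == 0%N); last by rewrite bnd_simp; lra.
      by rewrite bnd_simp /lo (eqP l0) mul0r; lra.
    move=> /allE[] // ; rewrite {1}/mkI /= itv_boundlr /= !bnd_simp UW => /andP[w1 w2] wk.
    have Wlt : W w < 0.
      move: w2; have [l0|l0] := boolP (nat_of_ord (l i) == 0%N); rewrite bnd_simp.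
        by rewrite /lo (eqP l0) mul0r; lra.
      have : 0 < lo i * (1 - p i) by rewrite mulr_gt0// divr_gt0// ltr0n lt0n.
      by lra.
    have w2' : W w - p i + 2^-1 <= 2^-1 - p i - lo i * (1 - p i).
      by move: w2; case: (_ == _); rewrite bnd_simp => // /ltW.
    have Sw : (0 <= W w) = false by apply/negbTE; rewrite -ltNge.
    split => //; apply/cellE; rewrite Vi V0 Sw; split => //.
      by rewrite ler_pdivlMr// ltr_pdivrMr//; apply/andP; split; lra.
    by rewrite /lo /hi (eqP li) mul0r lexx divr_gt0.
Qed.
End MarginalCells.

(** * Convergence *)

(** The excess of party i is symmetric in the gaps of the others, so exchanging two of them shows
    that all faces other than i contribute the same sum; only the weight of i and the total weight
    count. *)
Lemma riemann_sum_split_weight {R : realType} {n : nat} (p : 'I_n.+2 -> R) (beta : R)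
    (i : 'I_n.+2) (f : 'rV[R]_n.+2 -> R) (K : nat) : \sum_i p i = 1 ->
  (forall u v : 'rV[R]_n.+2, u ord0 i = v ord0 i -> f u = f v) ->
  riemann_sum p beta f (split_weight p i) K = riemann_sum p beta f p K.
Proof.
move=> p_sum fi.
pose F (l : {ffun 'I_n.+2 -> 'I_K}) := f (\row_h excess_of_gaps p beta (corner l) h).
pose S j := \sum_(l : {ffun 'I_n.+2 -> 'I_K}) F l * face_weight j l.
have RE (q : 'I_n.+2 -> R) : riemann_sum p beta f q K = \sum_j q j * S j.
  rewrite /riemann_sum /cell_weight; under eq_bigr do rewrite mulr_sumr.
  rewrite exchange_big /=; apply: eq_bigr => j _; rewrite mulr_sumr.
  by apply: eq_bigr => l _; rewrite mulrCA.
have S_sym (k : 'I_n.+1) : S (lift i k) = S (lift i ord0).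
  pose t := tperm (lift i ord0) (lift i k).
  pose sw (l : {ffun 'I_n.+2 -> 'I_K}) : {ffun 'I_n.+2 -> 'I_K} := [ffun h => l (t h)].
  have swK : involutive sw by move=> l; apply/ffunP => h; rewrite !ffunE tpermK.
  rewrite /S [RHS](reindex_inj (can_inj swK)) /=; apply: eq_bigr => l _.
  congr (_ * _); last by rewrite !face_weightE ffunE tpermL.
  apply: fi; rewrite !mxE /excess_of_gaps /corner; congr (_ * _ - _ + _).
    rewrite (reindex_inj (@perm_inj _ t)) /=; apply: eq_bigr => h _.
    by rewrite ffunE.
  by rewrite ffunE tpermD// eq_sym neq_lift.
rewrite !RE sum_split_weight [RHS](bigD1_ord i)//=; congr (_ + _).
under [RHS]eq_bigr do rewrite S_sym.
rewrite -mulr_suml; congr (_ * _).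
by rewrite -p_sum (bigD1_ord i)//= addrAC subrr add0r.
Qed.

Lemma bounded_fun_ex {R : realType} (E : Type) (f : E -> R) : bounded_fun f ->
  exists B : R, forall x, `|f x| <= B.
Proof. by move=> [M [_ fM]]; exists (M + 1) => x; apply: fM => //; rewrite ltrDl. Qed.

Section Convergence.
Context {R : realType} {m : nat} (p : 'I_m -> R) (beta : R).
Context {d : measure_display} (T : nat -> measurableType d)
  (P : forall N0, probability (T N0) R)
  (N : forall N0, {RV (P N0) >-> nat})
  (s : forall N0, 'I_m -> {RV (P N0) >-> nat}).
Hypothesis p_gt0 : forall i, 0 < p i.
Hypothesis p_sum : \sum_i p i = 1.
Hypothesis p_indep : rat_independent p.
Hypothesis N_unif : forall N0, (0 < N0)%N -> uniform_upto (P N0) N0 (N N0).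
Hypothesis s_alloc : forall N0, (0 < N0)%N -> forall w : T N0,
  divisor_defined m beta (N N0 w) ->
  divisor_allocation p beta (N N0 w) (fun i => s N0 i w).

(** Both expectations are close to the same Riemann sum: K is fixed first, and then n grows until
    C/n is small, C depending on K. *)
Lemma house_cvg d' (T' : measurableType d') (Q : probability T' R) (Y : T' -> R)
    (f : 'rV[R]_m -> R) :
  continuous f -> bounded_fun f ->
  (forall e : R, 0 < e -> exists K0 : nat, forall K, (K0 <= K)%N -> (0 < K)%N ->
    ('E_Q[Y] = (fine 'E_Q[Y])%:E)%E /\
    `|fine 'E_Q[Y]%E - riemann_sum p beta f p K| <= e) ->
  ('E_(P n)[fun w => f (\row_i seat_excess p (N n w) (fun j => s n j w) i)])%E
    @[n --> \oo] --> ('E_Q[Y])%E.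
Proof.
move=> fc /bounded_fun_ex[B fB] YQ.
have [K1 /(_ K1.+1 (leqnSn _) isT)[-> _]] := YQ 1 ltr01.
have house e : 0 < e -> exists K0 : nat, forall K, (K0 <= K)%N -> (0 < K)%N -> exists C : R,
    forall n, (0 < n)%N ->
    let X w := f (\row_i seat_excess p (N n w) (fun j => s n j w) i) in
    ('E_(P n)[X] = (fine 'E_(P n)[X])%:E)%E /\
    `|fine 'E_(P n)[X]%E - riemann_sum p beta f p K| <= e + C / n%:R.
  move=> e0; have [K0 K0P] := @house_riemann R m p beta p_gt0 p_sum p_indep f B e fc fB e0.
  exists K0 => K KK Kgt0; have [C CP] := K0P K KK Kgt0.
  by exists C => n n0; apply: CP => //; [exact: N_unif|exact: s_alloc].
apply/fine_cvgP; split.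
  have [K2 /(_ K2.+1 (leqnSn _) isT)[C CP]] := house 1 ltr01.
  by near=> n; have [|-> _] := CP n; [near: n; exact: nbhs_infty_gt|].
apply/cvgrPdist_le => e e0.
have e40 : 0 < e / 4 by lra.
have [K2 K2P] := house _ e40; have [K3 K3P] := YQ _ e40.
pose K := (K2 + K3).+1.
have [C CP] := K2P K (leq_trans (leq_addr _ _) (leqnSn _)) isT.
have [_ YK] := K3P K (leq_trans (leq_addl _ _) (leqnSn _)) isT.
near=> n.
have n0 : (0 < n)%N by near: n; exact: nbhs_infty_gt.
have [_ XK] := CP n n0.
have nR : 0 < n%:R :> R by rewrite ltr0n.
have Cn : C / n%:R <= e / 4.
  rewrite ler_pdivrMr// mulrC -ler_pdivrMr//.
  by near: n; exact: nbhs_infty_ger.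
apply: (le_trans (ler_distD (riemann_sum p beta f p K) _ _)).
by rewrite [X in _ + X]distrC; move: XK YK => /=; lra.
Unshelve. all: by end_near.
Qed.
End Convergence.

Theorem theorem3p7 (R : realType) (m : nat) (p : 'I_m -> R) (beta : R)
  (m_ge2 : (2 <= m)%N)
  (p_gt0 : forall i, 0 < p i)
  (p_sum : \sum_i p i = 1)
  (p_indep : rat_independent p)
  (d : measure_display) (T : nat -> measurableType d)
  (P : forall N0, probability (T N0) R)
  (N : forall N0, {RV (P N0) >-> nat})
  (s : forall N0, 'I_m -> {RV (P N0) >-> nat})
  (N_unif : forall N0, (0 < N0)%N -> uniform_upto (P N0) N0 (N N0))
  (s_alloc : forall N0, (0 < N0)%N -> forall w : T N0,
     divisor_defined m beta (N N0 w) ->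
     divisor_allocation p beta (N N0 w) (fun i => s N0 i w)) :
  (forall (d' : measure_display) (T' : measurableType d')
     (Q : probability T' R) (Ut : nat -> {RV Q >-> R}),
     (forall k, (k < m.-1)%N -> uniform_on ltNhalf (Ut k)) ->
     independent_systems Q (fun k : 'I_m.-1 => events_of (Ut k)) ->
     forall i : 'I_m,
       cvg_in_distribution P Q
         (fun N0 w => seat_excess p (N N0 w) (fun j => s N0 j w) i)
         (limit_marginal p beta (fun k => Ut k : T' -> R) i)) /\
  (forall (d' : measure_display) (T' : measurableType d')
     (Q : probability T' R) (U : 'I_m -> {RV Q >-> R}) (J : T' -> 'I_m),
     (forall j, uniform_on ltr01 (U j)) ->
     (forall j, measurable (J @^-1` [set j])) ->
     (forall j, Q (J @^-1` [set j]) = (p j)%:E) ->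
     independent_systems Q
       (fun o : option 'I_m =>
          if o is Some j then events_of (U j) else events_of_fin J) ->
     cvg_in_distribution P Q
       (fun N0 w =>
          (\row_i seat_excess p (N N0 w) (fun j => s N0 j w) i) : 'rV[R]_m)
       (fun w => (\row_i limit_joint p beta (fun j => U j : T' -> R) J i w) : 'rV[R]_m)).
Proof.
split=> [d' T' Q Ut Uu ind i g gc gb|d' T' Q U J Uu mJ QJ ind f fc fb]; last first.
  have [B fB] := bounded_fun_ex _ _ fb.
  have [mV VP] := joint_cell_event p Q U J Uu mJ QJ ind.
  apply: (house_cvg p beta T P N s p_gt0 p_sum p_indep N_unif s_alloc) => // e e0.
  have [K0 K0P] := @limit_riemann R m p beta p _ _ Q _ f B e p_gt0 p_sum p_sum mV VP fc fB e0.
  exists K0 => K KK Kgt0. exact: K0P.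
case: m m_ge2 p p_gt0 p_sum p_indep s s_alloc Ut Uu ind i => [|[|n]]// _.
move=> {}p {}p_gt0 {}p_sum {}p_indep {}s {}s_alloc Ut Uu ind i.
have [B gB] := bounded_fun_ex _ _ gb.
have pi1 := share_lt1 p i p_gt0 p_sum.
(* A test function of one excess is treated as a function of the whole row that depends on
   coordinate i only. *)
pose f (u : 'rV[R]_n.+2) := g (u ord0 i).
have fc : continuous f.
  by move=> u; apply: continuous_comp; [exact: coord_continuous|exact: gc].
have fB u : `|f u| <= B by exact: gB.
have fb : bounded_fun f.
  by move: gb => [M [Mr gM]]; exists M; split => // x Mx u _; exact: gM.
have [mV VP] := marginal_cell_event p i Q p_gt0 p_sum Ut Uu ind.
have q_sum : \sum_j split_weight p i j = 1.
  rewrite (eq_bigr (fun j => split_weight p i j * 1)) => [|j _]; last by rewrite mulr1.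
  by rewrite (sum_split_weight p i (fun=> 1)); ring.
have XE n' : g \o (fun w => seat_excess p (N n' w) (fun j => s n' j w) i) =
    (fun w => f (\row_i seat_excess p (N n' w) (fun j => s n' j w) i)).
  by apply/funext => w; rewrite /f mxE.
have YE : g \o limit_marginal p beta (fun k => Ut k : T' -> R) i =
    (fun w => f (\row_h excess_of_gaps p beta
       (fun j => split_gaps p i (fun k => Ut k : T' -> R) j w) h)).
  by apply/funext => w; rewrite /f mxE /= limit_marginalE// gt_eqF// subr_gt0.
under eq_fun do rewrite XE.
rewrite YE.
apply: (house_cvg p beta T P N s p_gt0 p_sum p_indep N_unif s_alloc) => // e e0.
have [K0 K0P] := @limit_riemann R n.+2 p beta (split_weight p i) _ _ Q _ f B e
  p_gt0 p_sum q_sum mV VP fc fB e0.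
exists K0 => K KK Kgt0; have := K0P K KK Kgt0.
by rewrite riemann_sum_split_weight// => u v uv; rewrite /f uv.
Qed.
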